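(* Let us assume that $\omega\in\mathfrak{A}$, where $\mathfrak{A}\subset\mathbb{R}$ is a band gap. Then the perturbed surface impedances, as $\delta\to0$, are decreasing functions of the frequency $\omega$, i.e. $$\frac{d\widetilde Z^+}{d\omega}<0,\qquad\frac{d\widetilde Z^-}{d\omega}<0,\qquad\text{for }\omega\in\mathfrak{A}.$$
   Context: Setting. $\mu_0>0$ is a constant (the magnetic permeability). The permittivities $\varepsilon_1,\varepsilon_2$ are real-valued (no damping), continuous functions of the frequency $\omega\in\mathbb{R}$, and are assumed to be piecewise non-decreasing in $\omega$, in the sense that $\frac{d\varepsilon}{d\omega}\ge 0$ whenever the derivative exists. Two materials $A$ and $B$ are semi-infinite arrays glued together at $x_0=0$; $A$ extends towards $-\infty$ and $B$ towards $+\infty$. Each is obtained by periodically repeating (with period $1$) a unit cell made of consecutive intervals (particles) in the order $D^{[1]}_1,D^{[2]}_1,D^{[1]}_2,\dots,D^{[2]}_N,D^{[1]}_{N+1}$ (the geometry depends on the material), arranged mirror symmetrically about the centre of the cell. Let $D^{[i]}$ be the union of the particles of type $i$, and $\varepsilon(x,\omega)=\varepsilon_i(\omega)$ for $x\in D^{[i]}$, $i=1,2$. Perturbation. Let $f(x,\omega)=f_i(\omega)$ for $x\in D^{[i]}$, $i=1,2$, be a real-valued function which is piecewise smooth in the frequency $\omega$ and satisfies $\frac{\partial f}{\partial\omega}<+\infty$. For a perturbation parameter $\delta>0$, set $\widetilde\varepsilon(x,\omega)=\varepsilon(x,\omega)+\delta f(x,\omega)$, i.e. $\widetilde\varepsilon=\widetilde\varepsilon_i:=\varepsilon_i+\delta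 f_i$ on $D^{[i]}$. The perturbed equation is $\widetilde{\mathcal L}u=\omega^2u$ with $$\widetilde{\mathcal L}u=-\frac1{\mu_0}\frac{d}{dx}\left(\frac{1}{\widetilde\varepsilon(x,\omega)}\frac{du}{dx}\right),$$ and the associated quasiperiodic problem imposes $u(x+1)=e^{i\kappa}u(x)$ with $\kappa\in[-\pi,\pi]$. Spectral bands are the sets of frequencies for which the quasiperiodic problem in the periodic medium has a non-zero solution for some $\kappa\in[-\pi,\pi]$; a band gap is an interval of frequencies between consecutive bands. Perturbed surface impedances: with $x_0^-$ and $x_0^+$ denoting left and right limits at $x_0$, $$\widetilde Z^-(\omega)=-\frac{u(x_0^-)}{\frac{1}{\widetilde\varepsilon_1(\omega)}\frac{du}{dx}(x_0^-)},\qquad \widetilde Z^+(\omega)=\frac{u(x_0^+)}{\frac{1}{\widetilde\varepsilon_1(\omega)}\frac{du}{dx}(x_0^+)},\qquad\omega\in\mathbb{R},$$ where, for $\omega$ in a band gap, $u$ in $\widetilde Z^-$ (resp. $\widetilde Z^+$) is the non-zero solution of the perturbed equation in material $A$ (resp. $B$) that decays as $x\to-\infty$ (resp. $x\to+\infty$).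
   Formalization: Proved for ω>0 (for ω<0 it fails: with constant ε and f=0, Z is even in ω), at ω in a gap of the unperturbed material where ε_1, ε_2 are nonzero and ε_i, f_i are differentiable; ''as δ→0'' means for all sufficiently small δ>0, with a threshold that may depend on ω. *)

(* Defs.v *)
From Stdlib Require Import Reals Rtopology ZArith List.
From Coquelicot Require Import Coquelicot.
Open Scope R_scope.

(** The unit cell [0,1] is cut by [node 0 < ... < node (2 N + 1)] into the
    particles D^[1]_1, D^[2]_1, D^[1]_2, ..., D^[2]_N, D^[1]_(N+1); particle
    number [k] (from 0) is of type 1 when [k] is even and of type 2 when [k]
    is odd. *)
Record unit_cell := UnitCell {
  npart : nat;
  node : nat -> R;
  npart_pos : (0 < npart)%nat;
  node_first : node 0 = 0;
  node_last : node (2 * npart + 1) = 1;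
  node_incr : forall k, (k < 2 * npart + 1)%nat -> node k < node (S k);
  node_mirror : forall k, (k <= 2 * npart + 1)%nat ->
    node (2 * npart + 1 - k) = 1 - node k
}.

Definition in_particle (c : unit_cell) (n : Z) (k : nat) (x : R) : Prop :=
  IZR n + node c k < x < IZR n + node c (S k).

(** D^[1] and D^[2] in the 1-periodic medium filling the whole line; their
    complement is the discrete set of interfaces. *)
Definition D1 (c : unit_cell) (x : R) : Prop :=
  exists (n : Z) (k : nat),
    (k < 2 * npart c + 1)%nat /\ Nat.Even k /\ in_particle c n k x.

Definition D2 (c : unit_cell) (x : R) : Prop :=
  exists (n : Z) (k : nat),
    (k < 2 * npart c + 1)%nat /\ Nat.Odd k /\ in_particle c n k x.

(** At [x], with constant permittivity [e] around it: [p] is the flux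
    (1/e) u', and -(1/mu0) p' = w^2 u. *)
Definition equation_at {V : NormedModule R_AbsRing}
    (mu0 e w : R) (u p : R -> V) (x : R) : Prop :=
  exists du dp : V,
    is_derive u x du /\ p x = scal (/ e) du /\
    is_derive p x dp /\ scal (- / mu0) dp = scal (w ^ 2) (u x).

(** L u = w^2 u on the open set [D], for the permittivity equal to [e1] on
    D^[1] and [e2] on D^[2]. As 1/epsilon jumps at the interfaces, the
    equation there means that [u] and its flux are continuous. *)
Definition solves {V : NormedModule R_AbsRing} (c : unit_cell)
    (mu0 e1 e2 w : R) (D : R -> Prop) (u : R -> V) : Prop :=
  exists p : R -> V, forall x, D x ->
    continuous u x /\ continuous p x /\
    (D1 c x -> equation_at mu0 e1 w u p x) /\
    (D2 c x -> equation_at mu0 e2 w u p x).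

(** The union of the spectral bands; Bloch solutions are complex-valued. *)
Definition bands (c : unit_cell) (mu0 : R) (eps1 eps2 : R -> R) (w : R) : Prop :=
  exists kappa : R, - PI <= kappa <= PI /\
  exists u : R -> C_R_NormedModule,
    solves c mu0 (eps1 w) (eps2 w) w (fun _ => True) u /\
    (exists x, u x <> zero) /\
    (forall x, u (x + 1) = Cmult (cos kappa, sin kappa) (u x)).

(** An open interval free of bands with bands at both ends. [adherence] rather
    than membership of the end points, since the problem is undefined at a
    frequency where a permittivity vanishes. *)
Definition is_band_gap (c : unit_cell) (mu0 : R) (eps1 eps2 : R -> R)
    (G : R -> Prop) : Prop :=
  exists a b : R, a < b /\
    (forall w, G w <-> a < w < b) /\
    (forall w, G w -> ~ bands c mu0 eps1 eps2 w) /\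
    adherence (bands c mu0 eps1 eps2) a /\
    adherence (bands c mu0 eps1 eps2) b.

(** [z] is -u(0-) / ((1/e1) u'(0-)) for a decaying solution [u] on (-oo,0). *)
Definition is_impedance_minus (c : unit_cell) (mu0 e1 e2 w z : R) : Prop :=
  exists u : R -> R,
    solves c mu0 e1 e2 w (fun x => x < 0) u /\
    (exists x, x < 0 /\ u x <> 0) /\
    is_lim u m_infty 0 /\
    exists u0 p0 : R,
      filterlim u (at_left 0) (locally u0) /\
      filterlim (fun x => / e1 * Derive u x) (at_left 0) (locally p0) /\
      p0 <> 0 /\ z = - (u0 / p0).

(** [z] is u(0+) / ((1/e1) u'(0+)) for a decaying solution [u] on (0,+oo). *)
Definition is_impedance_plus (c : unit_cell) (mu0 e1 e2 w z : R) : Prop :=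
  exists u : R -> R,
    solves c mu0 e1 e2 w (fun x => 0 < x) u /\
    (exists x, 0 < x /\ u x <> 0) /\
    is_lim u p_infty 0 /\
    exists u0 p0 : R,
      filterlim u (at_right 0) (locally u0) /\
      filterlim (fun x => / e1 * Derive u x) (at_right 0) (locally p0) /\
      p0 <> 0 /\ z = u0 / p0.

(** Definite descriptions: the values are meaningful at the frequencies where
    the impedance exists and is unique. *)
Definition impedance_minus (c : unit_cell) (mu0 : R) (eps1 eps2 : R -> R) (w : R) : R :=
  iota (is_impedance_minus c mu0 (eps1 w) (eps2 w) w : R_CompleteSpace -> Prop).

Definition impedance_plus (c : unit_cell) (mu0 : R) (eps1 eps2 : R -> R) (w : R) : R :=
  iota (is_impedance_plus c mu0 (eps1 w) (eps2 w) w : R_CompleteSpace -> Prop).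

Definition perturb (delta : R) (eps f : R -> R) (w : R) : R :=
  eps w + delta * f w.

Definition piecewise_nondecreasing (eps : R -> R) : Prop :=
  forall w, ex_derive eps w -> 0 <= Derive eps w.

(** Smooth away from a locally finite set of frequencies (jumps allowed). *)
Definition piecewise_smooth (f : R -> R) : Prop :=
  exists S : R -> Prop,
    (forall a b, exists l : list R, forall w, a <= w <= b -> S w -> In w l) /\
    (forall w, ~ S w -> forall n, ex_derive_n f n w).

(* Main.v *)
Require Import Defs.
From Stdlib Require Import Reals ZArith Lra Lia Classical.
From Coquelicot Require Import Coquelicot.
Open Scope R_scope.
Set Bullet Behavior "Strict Subproofs".

(** Write the equation as a system for the state (u, p), where p = (1/epsilon) u'
    is the flux: u' = epsilon p, p' = - mu0 w^2 u. States propagate through the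
    unit cell by a matrix T of determinant 1, the product of the explicit
    matrices of the layers. Mirror symmetry of the cell gives T the form
    ((a, b), (d, a)) ([cell_matrix_mirror]). If |a| <= 1, an eigenvector of
    modulus-one eigenvalue extends to a Bloch solution ([elliptic_in_bands]),
    so in a gap |a| > 1. Then b d = a^2 - 1 > 0, the decaying solutions on
    (0, +oo) are those whose initial state is on the eigenline of the eigenvalue
    l with |l| < 1, and the impedance is Z = - sign(a) sqrt(a^2 - 1) / d
    ([impedance_plus_eq]). Reflection x |-> - x preserves the medium and shows
    that Z^- is given by the same formula ([impedance_minus_eq]).

    Differentiating Z in the frequency, (1 - l^2) dZ/dw is the symplectic pairing
    of T v with (dT/dw) v at v = (Z, 1) ([dzval_neg]). This pairing is additive
    over the layers, and in each layer it is minus the integral of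
    2 mu0 w u^2 + (d epsilon/dw) p^2 ([is_derive_skew_layer]), hence negative when
    the permittivities are non-decreasing ([skew_dcell_matrix_neg]).

    The perturbed permittivities need not be monotone, but T, dT/dw and therefore
    dZ/dw depend continuously on delta at the fixed frequency, and the strict
    inequality at delta = 0 persists for small delta
    ([perturbed_derivative_neg]). Differentiability at one frequency only is
    needed, because a is continuous there and the formula for Z holds nearby. *)

(** * Generalised trigonometric functions *)

(** The even solution of [y'' = - z y] with [y 0 = 1], for [z] of either sign;
    [gsin] is the odd one with derivative 1 at 0. The value of [gsin] at [z = 0]
    is not meaningful; only [z = e * q] with nonzero factors matters. *)
Definition gcos (z x : R) : R :=
  if Rlt_dec 0 z then cos (sqrt z * x) else cosh (sqrt (- z) * x).

Definition gsin (z x : R) : R :=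
  if Rlt_dec 0 z then sin (sqrt z * x) / sqrt z
  else sinh (sqrt (- z) * x) / sqrt (- z).

Lemma gcos_0 (z : R) : gcos z 0 = 1.
Proof.
unfold gcos; destruct (Rlt_dec 0 z); rewrite Rmult_0_r.
- apply cos_0.
- unfold cosh; rewrite Ropp_0, exp_0; lra.
Qed.

Lemma gsin_0 (z : R) : gsin z 0 = 0.
Proof.
unfold gsin; destruct (Rlt_dec 0 z); rewrite Rmult_0_r.
- rewrite sin_0; unfold Rdiv; ring.
- unfold sinh; rewrite Ropp_0; unfold Rdiv; ring.
Qed.

Lemma sqrt_neq_0 (z : R) : 0 < z -> sqrt z <> 0.
Proof. intros h; apply Rgt_not_eq, sqrt_lt_R0, h. Qed.

Lemma gcos_gsin (z x : R) : z <> 0 -> gcos z x ^ 2 + z * gsin z x ^ 2 = 1.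
Proof.
intros hz; unfold gcos, gsin; destruct (Rlt_dec 0 z) as [h|h].
- pose proof (sqrt_neq_0 z h). rewrite <- (sqrt_sqrt z) at 2 by lra.
  pose proof (sin2_cos2 (sqrt z * x)) as e; unfold Rsqr in e.
  rewrite <- e; field; assumption.
- assert (h' : 0 < - z) by lra. pose proof (sqrt_neq_0 _ h').
  replace z with (- (sqrt (- z) * sqrt (- z))) at 2
    by (rewrite sqrt_sqrt; lra).
  unfold cosh, sinh. 
  assert (e : exp (sqrt (- z) * x) * exp (- (sqrt (- z) * x)) = 1)
    by (rewrite <- exp_plus, Rplus_opp_r; apply exp_0).
  rewrite <- e; field; assumption.
Qed.

Lemma is_derive_gcos_x (z x : R) : z <> 0 ->
  is_derive (gcos z) x (- (z * gsin z x)).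
Proof.
intros hz; unfold gcos, gsin; destruct (Rlt_dec 0 z) as [h|h].
- pose proof (sqrt_neq_0 z h). auto_derive; [trivial|].
  rewrite <- (sqrt_sqrt z) at 3 by lra. field; assumption.
- assert (h' : 0 < - z) by lra. pose proof (sqrt_neq_0 _ h').
  unfold cosh, sinh; auto_derive; [trivial|].
  replace z with (- (sqrt (- z) * sqrt (- z))) at 5
    by (rewrite sqrt_sqrt; lra). field; assumption.
Qed.

Lemma is_derive_gsin_x (z x : R) : z <> 0 ->
  is_derive (gsin z) x (gcos z x).
Proof.
intros hz; unfold gcos, gsin; destruct (Rlt_dec 0 z) as [h|h].
- pose proof (sqrt_neq_0 z h). auto_derive; [trivial|]. field; assumption.
- assert (h' : 0 < - z) by lra. pose proof (sqrt_neq_0 _ h').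
  unfold cosh, sinh; auto_derive; [trivial|]. field; assumption.
Qed.

Lemma is_derive_gcos_z (z x : R) : z <> 0 ->
  is_derive (fun y => gcos y x) z (- (x * gsin z x / 2)).
Proof.
intros hz; unfold gsin; destruct (Rlt_dec 0 z) as [h|h].
- apply (is_derive_ext_loc (fun y => cos (sqrt y * x))).
    apply (filter_imp (fun y => 0 < y)).
      intros y hy; unfold gcos, gsin; destruct (Rlt_dec 0 y); (reflexivity || (exfalso; lra)).
    apply open_gt, h.
  pose proof (sqrt_neq_0 z h). auto_derive; [assumption|]. field; assumption.
- assert (h' : 0 < - z) by lra. pose proof (sqrt_neq_0 _ h').
  apply (is_derive_ext_loc (fun y => cosh (sqrt (- y) * x))).
    apply (filter_imp (fun y => y < 0)).
      intros y hy; unfold gcos, gsin; destruct (Rlt_dec 0 y); (reflexivity || (exfalso; lra)).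
    apply open_lt; lra.
  unfold cosh, sinh; auto_derive; [repeat split; assumption|]. field; assumption.
Qed.

(** Together with [is_derive_gcos_z]: the derivatives in the parameter are
    algebraic in [gcos] and [gsin], with no case distinction on the sign of [z]. *)
Lemma is_derive_gsin_z (z x : R) : z <> 0 ->
  is_derive (fun y => gsin y x) z ((x * gcos z x - gsin z x) / (2 * z)).
Proof.
intros hz; unfold gcos, gsin; destruct (Rlt_dec 0 z) as [h|h].
- apply (is_derive_ext_loc (fun y => sin (sqrt y * x) / sqrt y)).
    apply (filter_imp (fun y => 0 < y)).
      intros y hy; unfold gcos, gsin; destruct (Rlt_dec 0 y); (reflexivity || (exfalso; lra)).
    apply open_gt, h.
  pose proof (sqrt_neq_0 z h). auto_derive; [repeat split; assumption|].
  replace (2 * z) with (2 * (sqrt z * sqrt z)) by (rewrite sqrt_sqrt; lra).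
  field; assumption.
- assert (h' : 0 < - z) by lra. pose proof (sqrt_neq_0 _ h').
  apply (is_derive_ext_loc (fun y => sinh (sqrt (- y) * x) / sqrt (- y))).
    apply (filter_imp (fun y => y < 0)).
      intros y hy; unfold gcos, gsin; destruct (Rlt_dec 0 y); (reflexivity || (exfalso; lra)).
    apply open_lt; lra.
  unfold cosh, sinh; auto_derive; [repeat split; assumption|].
  replace (2 * z) with (- (2 * (sqrt (- z) * sqrt (- z)))) by (rewrite sqrt_sqrt; lra).
  field; assumption.
Qed.

(** * Calculus on the real line *)

(** Replaces in the goal the derivative computed by the hypothesis [H], up to
    eta-conversion, by its value. *)
Ltac rw_derive H :=
  let e := fresh in
  pose proof (is_derive_unique _ _ _ H) as e;
  lazymatch type of e with
  | Derive ?f ?x = ?l =>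
    repeat match goal with
    | |- context [Derive ?g ?y] =>
      unify g f; unify y x; replace (Derive g y) with l by exact (eq_sym e)
    end
  end;
  clear e.

(** * Two by two matrices and ordered products *)

(** Real 2 by 2 matrices; they act on the states (u, p), where p is the flux
    (1/epsilon) u'. *)
Record mat2 := Mat { m11 : R; m12 : R; m21 : R; m22 : R }.

Definition mone : mat2 := Mat 1 0 0 1.

Definition madd (A B : mat2) : mat2 :=
  Mat (m11 A + m11 B) (m12 A + m12 B) (m21 A + m21 B) (m22 A + m22 B).

Definition mmul (A B : mat2) : mat2 :=
  Mat (m11 A * m11 B + m12 A * m21 B) (m11 A * m12 B + m12 A * m22 B)
      (m21 A * m11 B + m22 A * m21 B) (m21 A * m12 B + m22 A * m22 B).

Definition mdet (A : mat2) : R := m11 A * m22 A - m12 A * m21 A.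

Definition mapp (A : mat2) (v : R * R) : R * R :=
  (m11 A * fst v + m12 A * snd v, m21 A * fst v + m22 A * snd v).

(** Exchange of the diagonal entries. This is the anti-automorphism
    A |-> K adj(A) K with K = diag (1, -1), that is, propagation through the
    mirror image. *)
Definition mswap (A : mat2) : mat2 := Mat (m22 A) (m12 A) (m21 A) (m11 A).

Ltac mat_ring :=
  intros; unfold mmul, madd, mone, mapp, mswap, mdet; simpl;
  lazymatch goal with
  | |- Mat _ _ _ _ = _ => f_equal; ring
  | |- (_, _) = _ => f_equal; ring
  | _ => ring
  end.

Ltac mat_split := split; [|split; [|split]]; simpl.

Lemma mmul_assoc (A B C : mat2) : mmul A (mmul B C) = mmul (mmul A B) C.
Proof. mat_ring. Qed.

Lemma mmul_1_l (A : mat2) : mmul mone A = A.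
Proof. destruct A; mat_ring. Qed.

Lemma mmul_1_r (A : mat2) : mmul A mone = A.
Proof. destruct A; mat_ring. Qed.

Lemma mapp_mmul (A B : mat2) (v : R * R) : mapp (mmul A B) v = mapp A (mapp B v).
Proof. mat_ring. Qed.

Lemma mapp_1 (v : R * R) : mapp mone v = v.
Proof. destruct v; mat_ring. Qed.

Lemma mdet_mmul (A B : mat2) : mdet (mmul A B) = mdet A * mdet B.
Proof. mat_ring. Qed.

Lemma mswap_mmul (A B : mat2) : mswap (mmul A B) = mmul (mswap B) (mswap A).
Proof. mat_ring. Qed.

Lemma mapp_neq_0 (A : mat2) (v : R * R) :
  mdet A = 1 -> v <> (0, 0) -> mapp A v <> (0, 0).
Proof.
destruct v as [u p]; unfold mdet, mapp; simpl; intros h hv e; apply hv.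
injection e; intros e2 e1; f_equal.
- transitivity ((m11 A * m22 A - m12 A * m21 A) * u); [rewrite h; ring|].
  transitivity (m22 A * (m11 A * u + m12 A * p) - m12 A * (m21 A * u + m22 A * p));
    [ring|rewrite e1, e2; ring].
- transitivity ((m11 A * m22 A - m12 A * m21 A) * p); [rewrite h; ring|].
  transitivity (m11 A * (m21 A * u + m22 A * p) - m21 A * (m11 A * u + m12 A * p));
    [ring|rewrite e1, e2; ring].
Qed.

(** The ordered product [F (n-1) ... F 1 F 0], the first layer acting first. *)
Fixpoint mprod (F : nat -> mat2) (n : nat) : mat2 :=
  match n with O => mone | S k => mmul (F k) (mprod F k) end.

Lemma mprod_ext (F F' : nat -> mat2) (n : nat) :
  (forall i, (i < n)%nat -> F i = F' i) -> mprod F n = mprod F' n.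
Proof.
induction n as [|n IH]; intros h; simpl; [reflexivity|].
rewrite h by lia; rewrite IH; [reflexivity|intros; apply h; lia].
Qed.

Lemma mdet_mprod (F : nat -> mat2) (n : nat) :
  (forall i, mdet (F i) = 1) -> mdet (mprod F n) = 1.
Proof.
intros h; induction n as [|n IH]; simpl; [mat_ring|].
rewrite mdet_mmul, h, IH; ring.
Qed.

Lemma mprod_S_r (F : nat -> mat2) (n : nat) :
  mprod F (S n) = mmul (mprod (fun i => F (S i)) n) (F 0%nat).
Proof.
induction n as [|n IH]; [simpl; rewrite mmul_1_l, mmul_1_r; reflexivity|].
change (mprod F (S (S n))) with (mmul (F (S n)) (mprod F (S n))).
rewrite IH; simpl; apply mmul_assoc.
Qed.

(** As [mswap] reverses products, a palindromic product of fixed points of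
    [mswap] is again a fixed point. *)
Lemma mswap_mprod (F : nat -> mat2) (n : nat) :
  mswap (mprod F n) = mprod (fun i => mswap (F (n - 1 - i)%nat)) n.
Proof.
revert F; induction n as [|n IH]; intros F; [reflexivity|].
rewrite mprod_S_r, mswap_mmul, IH.
simpl mprod.
f_equal; [f_equal; f_equal; lia|].
apply mprod_ext; intros i hi; f_equal; f_equal; lia.
Qed.

(** * Matrix-valued functions *)

Definition is_derive_mat (F : R -> mat2) (w : R) (D : mat2) : Prop :=
  is_derive (fun x => m11 (F x)) w (m11 D) /\
  is_derive (fun x => m12 (F x)) w (m12 D) /\
  is_derive (fun x => m21 (F x)) w (m21 D) /\
  is_derive (fun x => m22 (F x)) w (m22 D).

Definition continuous_mat (F : R -> mat2) (x : R) : Prop :=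
  continuous (fun y => m11 (F y)) x /\ continuous (fun y => m12 (F y)) x /\
  continuous (fun y => m21 (F y)) x /\ continuous (fun y => m22 (F y)) x.

Lemma continuous_Rplus (f g : R -> R) (x : R) :
  continuous f x -> continuous g x -> continuous (fun y => f y + g y) x.
Proof. exact (continuous_plus f g x). Qed.

Lemma continuous_Rmult (f g : R -> R) (x : R) :
  continuous f x -> continuous g x -> continuous (fun y => f y * g y) x.
Proof. exact (continuous_mult f g x). Qed.

Lemma continuous_Ropp (f : R -> R) (x : R) :
  continuous f x -> continuous (fun y => - f y) x.
Proof. exact (continuous_opp f x). Qed.

Lemma continuous_Rdiv (f g : R -> R) (x : R) : g x <> 0 ->
  continuous f x -> continuous g x -> continuous (fun y => f y / g y) x.
Proof.
intros h hf hg; apply continuous_Rmult; [exact hf|].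
apply continuous_comp; [exact hg|].
apply continuity_pt_filterlim, continuity_pt_inv; [|exact h].
apply derivable_continuous_pt, derivable_pt_id.
Qed.

Lemma is_derive_continuous (f : R -> R) (x l : R) : is_derive f x l -> continuous f x.
Proof. intros h; apply (ex_derive_continuous f); exists l; exact h. Qed.

Lemma continuous_mat_comp (F : R -> mat2) (g : R -> R) (x : R) :
  continuous g x -> continuous_mat F (g x) -> continuous_mat (fun y => F (g y)) x.
Proof.
intros hg (a1 & a2 & a3 & a4); mat_split.
- apply (continuous_comp g (fun y => m11 (F y))); assumption.
- apply (continuous_comp g (fun y => m12 (F y))); assumption.
- apply (continuous_comp g (fun y => m21 (F y))); assumption.
- apply (continuous_comp g (fun y => m22 (F y))); assumption.
Qed.

Lemma continuous_shift (r x : R) : continuous (fun y => y - r) x.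
Proof.
apply (continuous_Rplus (fun y => y)); [apply continuous_id|apply continuous_const].
Qed.

Lemma continuous_mapp (F : R -> mat2) (v : R -> R * R) (x : R) :
  continuous_mat F x ->
  continuous (fun y => fst (v y)) x -> continuous (fun y => snd (v y)) x ->
  continuous (fun y => fst (mapp (F y) (v y))) x /\
  continuous (fun y => snd (mapp (F y) (v y))) x.
Proof.
intros (a1 & a2 & a3 & a4) b1 b2; split; simpl;
  apply continuous_Rplus; apply continuous_Rmult; assumption.
Qed.

Lemma is_derive_dot (f g h k : R -> R) (x df dg dh dk : R) :
  is_derive f x df -> is_derive g x dg -> is_derive h x dh -> is_derive k x dk ->
  is_derive (fun y => f y * g y + h y * k y) x
    (df * g x + dh * k x + (f x * dg + h x * dk)).
Proof.
intros hf hg hh hk; auto_derive; [repeat split; eexists; eassumption|].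
rw_derive hf; rw_derive hg; rw_derive hh; rw_derive hk; ring.
Qed.

Lemma is_derive_mat_mmul (F G : R -> mat2) (w : R) (DF DG : mat2) :
  is_derive_mat F w DF -> is_derive_mat G w DG ->
  is_derive_mat (fun x => mmul (F x) (G x)) w (madd (mmul DF (G w)) (mmul (F w) DG)).
Proof.
intros (a1 & a2 & a3 & a4) (b1 & b2 & b3 & b4).
mat_split; apply (is_derive_dot (fun x => _ (F x)) (fun x => _ (G x))
  (fun x => _ (F x)) (fun x => _ (G x))); assumption.
Qed.

Lemma continuous_mat_mmul (F G : R -> mat2) (x : R) :
  continuous_mat F x -> continuous_mat G x ->
  continuous_mat (fun y => mmul (F y) (G y)) x.
Proof.
intros (a1 & a2 & a3 & a4) (b1 & b2 & b3 & b4).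
mat_split; apply continuous_Rplus; apply continuous_Rmult; assumption.
Qed.

Lemma continuous_mat_madd (F G : R -> mat2) (x : R) :
  continuous_mat F x -> continuous_mat G x ->
  continuous_mat (fun y => madd (F y) (G y)) x.
Proof.
intros (a1 & a2 & a3 & a4) (b1 & b2 & b3 & b4).
mat_split; apply continuous_Rplus; assumption.
Qed.

Lemma is_derive_mat_continuous (F : R -> mat2) (x : R) (D : mat2) :
  is_derive_mat F x D -> continuous_mat F x.
Proof.
intros (a1 & a2 & a3 & a4); mat_split; eapply is_derive_continuous; eassumption.
Qed.

Lemma continuous_mat_const (A : mat2) (x : R) : continuous_mat (fun _ => A) x.
Proof. mat_split; apply continuous_const. Qed.

Lemma continuous_mat_mprod (F : nat -> R -> mat2) (n : nat) (x : R) :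
  (forall i, continuous_mat (F i) x) ->
  continuous_mat (fun y => mprod (fun i => F i y) n) x.
Proof.
intros h; induction n as [|n IH]; simpl; [apply continuous_mat_const|].
apply (continuous_mat_mmul (F n)); [apply h|exact IH].
Qed.

(** The derivative of [mprod F n] by the Leibniz rule, when [D i] is the
    derivative of [F i]. *)
Fixpoint dmprod (F D : nat -> mat2) (n : nat) : mat2 :=
  match n with
  | O => Mat 0 0 0 0
  | S k => madd (mmul (D k) (mprod F k)) (mmul (F k) (dmprod F D k))
  end.

Lemma is_derive_mat_mprod (F : nat -> R -> mat2) (D : nat -> mat2) (w : R) (n : nat) :
  (forall i, is_derive_mat (F i) w (D i)) ->
  is_derive_mat (fun x => mprod (fun i => F i x) n) w
    (dmprod (fun i => F i w) D n).
Proof.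
intros h; induction n as [|n IH]; simpl.
- split; [|split; [|split]]; (exact (is_derive_const (1 : R) w) || exact (is_derive_const (0 : R) w)).
- apply (is_derive_mat_mmul (F n)); [apply h|exact IH].
Qed.

Lemma continuous_mat_dmprod (F D : nat -> R -> mat2) (n : nat) (x : R) :
  (forall i, continuous_mat (F i) x) -> (forall i, continuous_mat (D i) x) ->
  continuous_mat (fun y => dmprod (fun i => F i y) (fun i => D i y) n) x.
Proof.
intros hF hD; induction n as [|n IH]; simpl; [apply continuous_mat_const|].
apply (continuous_mat_madd (fun y => mmul (D n y) (mprod (fun i => F i y) n))
  (fun y => mmul (F n y) (dmprod (fun i => F i y) (fun i => D i y) n))).
- apply (continuous_mat_mmul (D n)); [apply hD|apply continuous_mat_mprod, hF].
- apply (continuous_mat_mmul (F n)); [apply hF|exact IH].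
Qed.

(** * The skew form of a matrix and its derivative *)

(** The symplectic pairing of [A v] with [D v]. When [A] propagates states and
    [D] is its frequency derivative, the sign of this quadratic form of [v]
    decides the monotonicity of the impedance. *)
Definition skew (A D : mat2) (v : R * R) : R :=
  fst (mapp A v) * snd (mapp D v) - snd (mapp A v) * fst (mapp D v).

(** For determinant 1 the skew form is additive along a product, evaluated at
    the propagated state. *)
Lemma skew_mmul (A B DA DB : mat2) (v : R * R) :
  skew (mmul A B) (madd (mmul DA B) (mmul A DB)) v =
  skew A DA (mapp B v) + mdet A * skew B DB v.
Proof. unfold skew; mat_ring. Qed.

Lemma skew_dmprod_neg (F D : nat -> mat2) (n : nat) (v : R * R) :
  (forall i, mdet (F i) = 1) -> v <> (0, 0) ->
  (forall i v, (i < S n)%nat -> v <> (0, 0) -> skew (F i) (D i) v < 0) ->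
  skew (mprod F (S n)) (dmprod F D (S n)) v < 0.
Proof.
intros hdet hv.
enough (H : forall k, (forall i v, (i < k)%nat -> v <> (0, 0) -> skew (F i) (D i) v < 0) ->
    skew (mprod F k) (dmprod F D k) v <= 0).
- intros h; simpl; rewrite skew_mmul, hdet.
  assert (skew (F n) (D n) (mapp (mprod F n) v) < 0).
    apply h; [lia|]; apply mapp_neq_0; [apply mdet_mprod, hdet|exact hv].
  assert (skew (mprod F n) (dmprod F D n) v <= 0)
    by (apply H; intros; apply h; [lia|assumption]).
  lra.
- intros k; induction k as [|k IH]; intros h; simpl.
  { unfold skew; simpl; lra. }
  rewrite skew_mmul, hdet.
  assert (skew (F k) (D k) (mapp (mprod F k) v) < 0).
    apply h; [lia|]; apply mapp_neq_0; [apply mdet_mprod, hdet|exact hv].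
  assert (skew (mprod F k) (dmprod F D k) v <= 0)
    by (apply IH; intros; apply h; [lia|assumption]).
  lra.
Qed.

(** * Homogeneous layers *)

(** Propagation of the state (u, p) over a length [x] of a medium of constant
    permittivity [e], with [q = mu0 * w ^ 2]: u' = e p, p' = - q u. *)
Definition layer (q e x : R) : mat2 :=
  Mat (gcos (e * q) x) (e * gsin (e * q) x) (- (q * gsin (e * q) x)) (gcos (e * q) x).

(** The derivative of [layer q e x] in the frequency, given the derivatives [dq]
    of [q] and [de] of [e]. *)
Definition dlayer (q dq e de x : R) : mat2 :=
  let dz := de * q + e * dq in
  let dC := - (x * gsin (e * q) x / 2) * dz in
  let dS := (x * gcos (e * q) x - gsin (e * q) x) / (2 * (e * q)) * dz in
  Mat dC (de * gsin (e * q) x + e * dS) (- (dq * gsin (e * q) x + q * dS)) dC.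

Lemma layer_0 (q e : R) : layer q e 0 = mone.
Proof. unfold layer, mone; rewrite gcos_0, gsin_0; f_equal; ring. Qed.

Lemma mdet_layer (q e x : R) : e * q <> 0 -> mdet (layer q e x) = 1.
Proof.
intros h; unfold mdet; simpl; rewrite <- (gcos_gsin (e * q) x h); ring.
Qed.

Lemma mswap_layer (q e x : R) : mswap (layer q e x) = layer q e x.
Proof. reflexivity. Qed.

Lemma is_derive_mat_layer_x (q e x : R) : e * q <> 0 ->
  is_derive_mat (layer q e) x (mmul (Mat 0 e (- q) 0) (layer q e x)).
Proof.
intros h.
pose proof (is_derive_gcos_x (e * q) x h) as hC.
pose proof (is_derive_gsin_x (e * q) x h) as hS.
mat_split; auto_derive;
  try (repeat split; eexists; eassumption);
  rw_derive hC; rw_derive hS; ring.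
Qed.

Lemma is_derive_mat_layer (q e : R -> R) (w dq de x : R) : e w * q w <> 0 ->
  is_derive q w dq -> is_derive e w de ->
  is_derive_mat (fun t => layer (q t) (e t) x) w (dlayer (q w) dq (e w) de x).
Proof.
intros h hq he.
assert (hz : is_derive (fun t => e t * q t) w (de * q w + e w * dq)).
{ auto_derive; [repeat split; eexists; eassumption|].
  rw_derive he; rw_derive hq; ring. }
assert (hC : is_derive (fun t => gcos (e t * q t) x) w (m11 (dlayer (q w) dq (e w) de x))).
{ evar_last.
  - apply (is_derive_comp (fun z => gcos z x) (fun t => e t * q t));
      [apply is_derive_gcos_z, h|exact hz].
  - unfold scal; simpl; unfold mult; simpl; ring. }
assert (hS : is_derive (fun t => gsin (e t * q t) x) w
   ((x * gcos (e w * q w) x - gsin (e w * q w) x) / (2 * (e w * q w)) * (de * q w + e w * dq))).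
{ evar_last.
  - apply (is_derive_comp (fun z => gsin z x) (fun t => e t * q t));
      [apply is_derive_gsin_z, h|exact hz].
  - unfold scal; simpl; unfold mult; simpl; ring. }
set (S := fun t => gsin (e t * q t) x) in hS.
mat_split; [exact hC| | |exact hC];
  [apply (is_derive_ext (fun t => e t * S t)); [reflexivity|]
  |apply (is_derive_ext (fun t => - (q t * S t))); [reflexivity|]];
  auto_derive; try (repeat split; eexists; eassumption);
  rw_derive he; rw_derive hq; rw_derive hS; unfold S; ring.
Qed.

(** The energy identity, valid for either sign of [e] and [q]. *)
Lemma is_derive_skew_layer (q dq e de x : R) (v : R * R) : e * q <> 0 ->
  is_derive (fun y => skew (layer q e y) (dlayer q dq e de y) v) x
    (- (dq * fst (mapp (layer q e x) v) ^ 2 + de * snd (mapp (layer q e x) v) ^ 2)).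
Proof.
intros h.
assert (e <> 0) by (intros ->; apply h; ring).
assert (q <> 0) by (intros ->; apply h; ring).
pose proof (is_derive_gcos_x (e * q) x h) as hC.
pose proof (is_derive_gsin_x (e * q) x h) as hS.
unfold skew; simpl; auto_derive.
- repeat split; eexists; eassumption.
- rw_derive hC; rw_derive hS.
  destruct v as [u p]; simpl; field; split; assumption.
Qed.

(** The inequality is strict although [de] may be 0: [u] cannot vanish throughout
    the layer. *)
Lemma skew_layer_neg (q dq e de x : R) (v : R * R) :
  e * q <> 0 -> 0 < dq -> 0 <= de -> 0 < x -> v <> (0, 0) ->
  skew (layer q e x) (dlayer q dq e de x) v < 0.
Proof.
intros h hdq hde hx hv.
assert (he : e <> 0) by (intros ->; apply h; ring).
assert (hq : q <> 0) by (intros ->; apply h; ring).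
set (W := fun y => skew (layer q e y) (dlayer q dq e de y) v).
set (U := fun y => fst (mapp (layer q e y) v)).
set (P := fun y => snd (mapp (layer q e y) v)).
set (DW := fun y => - (dq * U y ^ 2 + de * P y ^ 2)).
assert (hW : forall y, is_derive W y (DW y)) by (intros; apply is_derive_skew_layer, h).
assert (hU : forall y, is_derive U y (e * P y)).
{ intros y; destruct (is_derive_mat_layer_x q e y h) as (a1 & a2 & _ & _).
  unfold U, P, mapp; simpl fst; simpl snd.
  apply (is_derive_ext (fun y => m11 (layer q e y) * fst v + m12 (layer q e y) * snd v));
    [reflexivity|].
  evar_last.
  - apply (is_derive_dot (fun y => m11 (layer q e y)) (fun _ => fst v)
      (fun y => m12 (layer q e y)) (fun _ => snd v));
    [exact a1|exact (is_derive_const (fst v) y)|exact a2|exact (is_derive_const (snd v) y)].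
  - unfold zero; simpl; ring. }
assert (hle : forall y, DW y <= 0).
{ intros y; unfold DW.
  assert (0 <= dq * U y ^ 2) by (apply Rmult_le_pos; [lra|apply pow2_ge_0]).
  assert (0 <= de * P y ^ 2) by (apply Rmult_le_pos; [lra|apply pow2_ge_0]). lra. }
assert (hmono : forall y z, y <= z -> W z <= W y).
{ intros y z hyz.
  destruct (MVT_gen W y z DW) as (t & _ & ht).
  - intros; apply hW.
  - intros; apply continuity_pt_filterlim, (is_derive_continuous W _ _ (hW _)).
  - specialize (hle t). nra. }
assert (hW0 : W 0 = 0).
{ unfold W, skew; simpl; rewrite gcos_0, gsin_0; field; split; assumption. }
change (W x < 0).
(* Strictness: otherwise [W] is constant, so [U] and then [P] vanish inside the
   layer, against the invertibility of the layer matrix. *)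
destruct (Rlt_or_le (W x) 0) as [|hx0]; [assumption|exfalso].
assert (hconst : forall y, 0 <= y <= x -> W y = 0).
{ intros y hy; apply Rle_antisym.
  - rewrite <- hW0; apply hmono; lra.
  - apply Rle_trans with (1 := hx0); apply hmono; lra. }
assert (hloc : forall y, 0 < y < x -> locally y (fun t => 0 < t < x)).
{ intros y hy; apply (open_and (fun t => 0 < t) (fun t => t < x)); [apply open_gt|apply open_lt|exact hy]. }
assert (hU0 : forall y, 0 < y < x -> U y = 0).
{ intros y hy.
  assert (e1 : DW y = 0).
  { rewrite <- (is_derive_unique _ _ _ (hW y)).
    apply is_derive_unique, (is_derive_ext_loc (fun _ => 0)); [|exact (is_derive_const (0 : R) y)].
    apply filter_imp with (2 := hloc y hy); intros t ht; symmetry; apply hconst; lra. }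
  unfold DW in e1.
  assert (0 <= de * P y ^ 2) by (apply Rmult_le_pos; [lra|apply pow2_ge_0]).
  pose proof (pow2_ge_0 (U y)).
  assert (U y ^ 2 = 0) by nra. apply Rsqr_0_uniq; unfold Rsqr; lra. }
apply (mapp_neq_0 (layer q e (x / 2)) v); [apply mdet_layer, h|exact hv|].
rewrite (surjective_pairing (mapp _ _)); f_equal; [apply hU0; lra|].
assert (e1 : e * P (x / 2) = 0).
{ rewrite <- (is_derive_unique _ _ _ (hU (x / 2))).
  apply is_derive_unique, (is_derive_ext_loc (fun _ => 0)); [|exact (is_derive_const (0 : R) _)].
  apply filter_imp with (2 := hloc (x / 2) ltac:(lra)); intros t ht; symmetry; apply hU0; lra. }
apply Rmult_integral in e1; destruct e1; [contradiction|assumption].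
Qed.

(** * The transfer matrix of the unit cell *)

Definition width (c : unit_cell) (k : nat) : R := node c (S k) - node c k.

(** Layer number [k] of the cell, of type 1 when [k] is even. *)
Definition klayer (q e1 e2 : R) (k : nat) (x : R) : mat2 :=
  layer q (if Nat.even k then e1 else e2) x.

(** Propagation through the first [n] particles of the cell. *)
Definition transfer (c : unit_cell) (q e1 e2 : R) (n : nat) : mat2 :=
  mprod (fun k => klayer q e1 e2 k (width c k)) n.

Definition cell_matrix (c : unit_cell) (q e1 e2 : R) : mat2 :=
  transfer c q e1 e2 (2 * npart c + 1).

Lemma mdet_klayer (q e1 e2 : R) (k : nat) (x : R) :
  q <> 0 -> e1 <> 0 -> e2 <> 0 -> mdet (klayer q e1 e2 k x) = 1.
Proof.
intros hq h1 h2; apply mdet_layer; destruct (Nat.even k);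
  apply Rmult_integral_contrapositive_currified; assumption.
Qed.

Lemma mdet_cell_matrix (c : unit_cell) (q e1 e2 : R) :
  q <> 0 -> e1 <> 0 -> e2 <> 0 -> mdet (cell_matrix c q e1 e2) = 1.
Proof. intros hq h1 h2; apply mdet_mprod; intros; apply mdet_klayer; assumption. Qed.

(** Mirror symmetry of the cell makes the diagonal of its transfer matrix
    constant. Hence neither u(0) nor p(0) can vanish for a decaying solution:
    in a gap the impedance has neither poles nor zeros. *)
Lemma cell_matrix_mirror (c : unit_cell) (q e1 e2 : R) :
  m11 (cell_matrix c q e1 e2) = m22 (cell_matrix c q e1 e2).
Proof.
assert (e : mswap (cell_matrix c q e1 e2) = cell_matrix c q e1 e2).
{ unfold cell_matrix, transfer; rewrite mswap_mprod.
  apply mprod_ext; intros i hi; unfold klayer; rewrite mswap_layer.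
  set (n := npart c) in *.
  replace (2 * n + 1 - 1 - i)%nat with (2 * n - i)%nat by lia.
  f_equal.
  - rewrite Nat.even_sub by lia; rewrite Nat.even_mul; simpl.
    destruct (Nat.even i); reflexivity.
  - unfold width.
    replace (S (2 * n - i)) with (2 * n + 1 - i)%nat by lia.
    replace (2 * n - i)%nat with (2 * n + 1 - S i)%nat by lia.
    unfold n; rewrite !node_mirror by (unfold n in hi; lia). ring. }
change (m22 (mswap (cell_matrix c q e1 e2)) = m22 (cell_matrix c q e1 e2)).
rewrite e; reflexivity.
Qed.

Lemma node_le (c : unit_cell) (i j : nat) :
  (i <= j)%nat -> (j <= 2 * npart c + 1)%nat -> node c i <= node c j.
Proof.
induction 1 as [|j hij IH]; intros hj; [lra|].
apply Rle_trans with (node c j); [apply IH; lia|].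
apply Rlt_le, node_incr; lia.
Qed.

Lemma node_bounds (c : unit_cell) (k : nat) :
  (k <= 2 * npart c + 1)%nat -> 0 <= node c k <= 1.
Proof.
intros hk; rewrite <- (node_first c) at 1; rewrite <- (node_last c).
split; apply node_le; lia.
Qed.

Lemma width_pos (c : unit_cell) (k : nat) : (k < 2 * npart c + 1)%nat -> 0 < width c k.
Proof. intros hk; unfold width; pose proof (node_incr c k hk); lra. Qed.

(** * Solutions on the whole line *)

(** Projection of [t] onto [[0, l]]. *)
Definition clamp (l t : R) : R := Rmax 0 (Rmin t l).

Lemma clamp_le (l t : R) : t <= 0 -> clamp l t = 0.
Proof.
intros h; unfold clamp; apply Rmax_left.
apply Rle_trans with (1 := Rmin_l t l), h.
Qed.

Lemma clamp_in (l t : R) : 0 <= t <= l -> clamp l t = t.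
Proof. intros h; unfold clamp; rewrite Rmin_left, Rmax_right; lra. Qed.

Lemma clamp_ge (l t : R) : 0 <= l <= t -> clamp l t = l.
Proof. intros h; unfold clamp; rewrite Rmin_right, Rmax_right; lra. Qed.

Lemma continuous_clamp (l t : R) : continuous (clamp l) t.
Proof.
(* Minimum and maximum expressed by absolute values. *)
apply (continuous_ext (fun t => (0 + ((t + l - Rabs (t - l)) / 2) +
    Rabs (0 - (t + l - Rabs (t - l)) / 2)) / 2)).
- intros s; unfold clamp.
  replace ((s + l - Rabs (s - l)) / 2) with (Rmin s l).
  + unfold Rmax, Rabs; destruct (Rle_dec 0 _), (Rcase_abs _); lra.
  + unfold Rmin, Rabs; destruct (Rle_dec _ _), (Rcase_abs _); lra.
- assert (h1 : forall r : R, continuous (fun t => t + r) t).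
  { intros r; apply (continuous_Rplus (fun t => t)); [apply continuous_id|apply continuous_const]. }
  assert (h2 : continuous (fun t => (t + l - Rabs (t - l)) / 2) t).
  { apply continuous_Rmult; [|apply continuous_const].
    apply (continuous_Rplus (fun t => t + l)); [apply h1|].
    apply continuous_Ropp, (continuous_comp (fun t => t - l)); [apply (h1 (- l))|].
    apply continuous_Rabs. }
  apply continuous_Rmult; [|apply continuous_const].
  apply continuous_Rplus; [apply continuous_Rplus; [apply continuous_const|exact h2]|].
  apply (continuous_comp (fun t => 0 - (t + l - Rabs (t - l)) / 2)); [|apply continuous_Rabs].
  apply continuous_Rplus; [apply continuous_const|apply continuous_Ropp, h2].
Qed.

(** Propagation from 0 to [y] in the cell, as a product in which a layer that is
    not reached yet contributes the identity and a layer already crossed its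
    full matrix. Continuity across the interfaces is then automatic. *)
Definition fund (c : unit_cell) (q e1 e2 : R) (n : nat) (y : R) : mat2 :=
  mprod (fun k => klayer q e1 e2 k (clamp (width c k) (y - node c k))) n.

Definition cell_fund (c : unit_cell) (q e1 e2 : R) : R -> mat2 :=
  fund c q e1 e2 (2 * npart c + 1).

Lemma Int_part_eq (n : Z) (x : R) : IZR n <= x < IZR n + 1 -> Int_part x = n.
Proof. intros h; symmetry; apply Int_part_spec; lra. Qed.

Section Cell.

Variables (c : unit_cell) (q e1 e2 : R).
Hypotheses (hq : q <> 0) (h1 : e1 <> 0) (h2 : e2 <> 0).

Lemma fund_right (n : nat) (y : R) : (n <= 2 * npart c + 1)%nat -> node c n <= y ->
  fund c q e1 e2 n y = transfer c q e1 e2 n.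
Proof.
intros hn hy; apply mprod_ext; intros i hi; f_equal; apply clamp_ge.
pose proof (width_pos c i ltac:(lia)) as hw.
pose proof (node_le c (S i) n ltac:(lia) hn).
unfold width in *; lra.
Qed.

Lemma fund_left (n : nat) (y : R) : (n <= 2 * npart c + 1)%nat -> y <= 0 ->
  fund c q e1 e2 n y = mone.
Proof.
intros hn hy; induction n as [|n IH]; [reflexivity|].
unfold fund; simpl; unfold fund in IH; rewrite IH by lia.
pose proof (node_bounds c n ltac:(lia)).
rewrite clamp_le by lra; unfold klayer; rewrite layer_0; apply mmul_1_l.
Qed.

Lemma fund_in (n k : nat) (y : R) : (k < n)%nat -> (n <= 2 * npart c + 1)%nat ->
  node c k <= y <= node c (S k) ->
  fund c q e1 e2 n y = mmul (klayer q e1 e2 k (y - node c k)) (transfer c q e1 e2 k).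
Proof.
intros hk; induction hk as [|n hk IH]; intros hn hy; unfold fund; simpl.
- rewrite clamp_in by (unfold width; lra).
  f_equal; apply fund_right; [lia|lra].
- unfold fund in IH; rewrite IH by (assumption || lia).
  pose proof (node_le c (S k) n ltac:(lia) ltac:(lia)).
  rewrite clamp_le by lra; unfold klayer at 1; rewrite layer_0; apply mmul_1_l.
Qed.

Lemma continuous_klayer (k : nat) (x : R) : continuous_mat (klayer q e1 e2 k) x.
Proof.
eapply is_derive_mat_continuous, is_derive_mat_layer_x; destruct (Nat.even k);
  apply Rmult_integral_contrapositive_currified; assumption.
Qed.

Lemma continuous_cell_fund (y : R) : continuous_mat (cell_fund c q e1 e2) y.
Proof.
apply (continuous_mat_mprod
  (fun k y => klayer q e1 e2 k (clamp (width c k) (y - node c k)))).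
intros k; apply (continuous_mat_comp (klayer q e1 e2 k)
  (fun y => clamp (width c k) (y - node c k))); [|apply continuous_klayer].
apply (continuous_comp (fun y => y - node c k)); [apply continuous_shift|apply continuous_clamp].
Qed.

Lemma cell_fund_0 (y : R) : y <= 0 -> cell_fund c q e1 e2 y = mone.
Proof. intros; apply fund_left; [lia|assumption]. Qed.

Lemma cell_fund_1 (y : R) : 1 <= y -> cell_fund c q e1 e2 y = cell_matrix c q e1 e2.
Proof. intros; apply fund_right; [lia|rewrite node_last; assumption]. Qed.

Variable v : Z -> R * R.
Hypothesis hv : forall n, v (n + 1)%Z = mapp (cell_matrix c q e1 e2) (v n).

(** The solution whose states at the integers are [v], for a sequence [v]
    compatible with the transfer matrix of the cell. *)
Definition glued (x : R) : R * R :=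
  mapp (cell_fund c q e1 e2 (x - IZR (Int_part x))) (v (Int_part x)).

(** A formula valid on both sides of the integer [n], where the floor jumps. *)
Lemma glued_two_cells (n : Z) (x : R) : IZR n - 1 < x < IZR n + 1 ->
  glued x = mapp (cell_fund c q e1 e2 (x - IZR n))
              (mapp (cell_fund c q e1 e2 (x - IZR (n - 1))) (v (n - 1)%Z)).
Proof.
intros hx; unfold glued; rewrite minus_IZR.
destruct (Rlt_or_le x (IZR n)) as [h|h].
- rewrite (Int_part_eq (n - 1)) by (rewrite minus_IZR; lra).
  rewrite (cell_fund_0 (x - IZR n)) by lra; rewrite mapp_1, minus_IZR; reflexivity.
- rewrite (Int_part_eq n) by lra.
  rewrite (cell_fund_1 (x - (IZR n - 1))) by lra.
  rewrite <- hv; do 2 f_equal; lia.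
Qed.

Lemma continuous_glued (x : R) :
  continuous (fun y => fst (glued y)) x /\ continuous (fun y => snd (glued y)) x.
Proof.
set (n := Int_part x).
assert (hloc : locally x (fun y => IZR n - 1 < y < IZR n + 1)).
{ destruct (base_Int_part x); fold n in H, H0.
  apply (open_and (fun y => IZR n - 1 < y) (fun y => y < IZR n + 1));
    [apply open_gt|apply open_lt|lra]. }
assert (h : forall m y, continuous_mat (fun x => cell_fund c q e1 e2 (x - IZR m)) y).
{ intros m y; apply (continuous_mat_comp _ (fun x => x - IZR m));
  [apply continuous_shift|apply continuous_cell_fund]. }
destruct (continuous_mapp (fun y => cell_fund c q e1 e2 (y - IZR (n - 1)))
  (fun _ => v (n - 1)%Z) x (h _ _)) as [a1 a2]; [apply continuous_const..|].
destruct (continuous_mapp (fun y => cell_fund c q e1 e2 (y - IZR n)) _ x (h _ _) a1 a2)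
  as [b1 b2].
split; [eapply continuous_ext_loc, b1|eapply continuous_ext_loc, b2];
  apply filter_imp with (2 := hloc); intros y hy;
  rewrite (glued_two_cells n y hy); reflexivity.
Qed.

Lemma is_derive_glued (n : Z) (k : nat) (x : R) :
  (k < 2 * npart c + 1)%nat -> in_particle c n k x ->
  is_derive (fun y => fst (glued y)) x
    ((if Nat.even k then e1 else e2) * snd (glued x)) /\
  is_derive (fun y => snd (glued y)) x (- q * fst (glued x)).
Proof.
intros hk hx; unfold in_particle in hx.
set (e := if Nat.even k then e1 else e2).
assert (he : e * q <> 0)
  by (unfold e; destruct (Nat.even k); apply Rmult_integral_contrapositive_currified; assumption).
set (r := IZR n + node c k) in *.
set (v0 := mapp (transfer c q e1 e2 k) (v n)).
assert (heq : forall y, r < y < IZR n + node c (S k) -> mapp (layer q e (y - r)) v0 = glued y).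
{ intros y hy; unfold glued, r in *.
  pose proof (node_bounds c k ltac:(lia)); pose proof (node_bounds c (S k) ltac:(lia)).
  rewrite (Int_part_eq n) by lra.
  unfold cell_fund; rewrite (fund_in _ k) by (lia || lra).
  rewrite mapp_mmul; unfold klayer; fold e; f_equal; f_equal; ring. }
assert (hloc : locally x (fun y => r < y < IZR n + node c (S k))).
{ apply (open_and (fun y => r < y) (fun y => y < IZR n + node c (S k)));
    [apply open_gt|apply open_lt|exact hx]. }
destruct (is_derive_mat_layer_x q e (x - r) he) as (a1 & a2 & a3 & a4).
assert (hcomp : forall (f : R -> R) (l : R), is_derive f (x - r) l -> is_derive (fun y => f (y - r)) x l).
{ intros f l hf; evar_last; [apply (is_derive_comp f (fun y => y - r)); [exact hf|]|].
  - apply (is_derive_ext (fun y => y - r)); [reflexivity|].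
    auto_derive; [trivial|reflexivity].
  - unfold scal; simpl; unfold mult; simpl; ring. }
assert (hz : forall t : R, is_derive (fun _ : R => t) x 0) by (intros t; exact (is_derive_const t x)).
rewrite <- (heq x hx).
split.
- apply (is_derive_ext_loc (fun y => m11 (layer q e (y - r)) * fst v0 + m12 (layer q e (y - r)) * snd v0)).
  { apply filter_imp with (2 := hloc); intros y hy; rewrite <- (heq y hy); reflexivity. }
  evar_last.
  + apply (is_derive_dot (fun y => m11 (layer q e (y - r))) (fun _ => fst v0)
      (fun y => m12 (layer q e (y - r))) (fun _ => snd v0));
    [exact (hcomp _ _ a1)|apply hz|exact (hcomp _ _ a2)|apply hz].
  + simpl; ring.
- apply (is_derive_ext_loc (fun y => m21 (layer q e (y - r)) * fst v0 + m22 (layer q e (y - r)) * snd v0)).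
  { apply filter_imp with (2 := hloc); intros y hy; rewrite <- (heq y hy); reflexivity. }
  evar_last.
  + apply (is_derive_dot (fun y => m21 (layer q e (y - r))) (fun _ => fst v0)
      (fun y => m22 (layer q e (y - r))) (fun _ => snd v0));
    [exact (hcomp _ _ a3)|apply hz|exact (hcomp _ _ a4)|apply hz].
  + simpl; ring.
Qed.

End Cell.

(** * The equation as a first-order system *)

Lemma equation_at_R (mu0 e w : R) (u p : R -> R) (x : R) : mu0 <> 0 -> e <> 0 ->
  equation_at (V := R_NormedModule) mu0 e w u p x <->
  is_derive u x (e * p x) /\ is_derive p x (- (mu0 * w ^ 2) * u x).
Proof.
intros hmu he; unfold equation_at, scal; simpl; unfold mult; simpl.
split.
- intros (du & dp & hu & hp & hdp & hup); split.
  + replace (e * p x) with du; [exact hu|rewrite hp; field; exact he].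
  + replace (- (mu0 * (w * (w * 1))) * u x) with dp; [exact hdp|].
    transitivity (- mu0 * (- / mu0 * dp)); [field; exact hmu|rewrite hup; ring].
- intros [hu hp]; exists (e * p x), (- (mu0 * (w * (w * 1))) * u x).
  split; [exact hu|split; [field; exact he|split; [exact hp|field; exact hmu]]].
Qed.

(** [u] solves the equation on [D] with flux [p], written as the first-order
    system u' = e p, p' = - q u in the particles. *)
Definition solves_with (c : unit_cell) (q e1 e2 : R) (D : R -> Prop) (u p : R -> R) : Prop :=
  (forall x, D x -> continuous u x /\ continuous p x) /\
  forall n k x, D x -> (k < 2 * npart c + 1)%nat -> in_particle c n k x ->
    is_derive u x ((if Nat.even k then e1 else e2) * p x) /\
    is_derive p x (- q * u x).

Lemma solves_R (c : unit_cell) (mu0 e1 e2 w : R) (D : R -> Prop) (u : R -> R) :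
  mu0 <> 0 -> e1 <> 0 -> e2 <> 0 ->
  solves (V := R_NormedModule) c mu0 e1 e2 w D u <->
  exists p, solves_with c (mu0 * w ^ 2) e1 e2 D u p.
Proof.
intros hmu h1 h2; split; intros [p H]; exists p.
- split.
  + intros x hx; destruct (H x hx) as (a & b & _); split; assumption.
  + intros n k x hx hk hxk; destruct (H x hx) as (_ & _ & HD1 & HD2).
    destruct (Nat.even k) eqn:ek.
    * apply equation_at_R; [assumption..|]; apply HD1; exists n, k.
      repeat split; [assumption|apply Nat.even_spec, ek|apply hxk..].
    * apply equation_at_R; [assumption..|]; apply HD2; exists n, k.
      repeat split; [assumption| |apply hxk..].
      apply Nat.odd_spec; unfold Nat.odd; rewrite ek; reflexivity.
- destruct H as [hc hd]; intros x hx; destruct (hc x hx) as [a b].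
  split; [exact a|split; [exact b|]].
  split; intros (n & k & hk & ek & hxk); apply equation_at_R; try assumption;
    destruct (hd n k x hx hk hxk) as [d1 d2].
  + rewrite (proj2 (Nat.even_spec k) ek) in d1; split; assumption.
  + apply Nat.odd_spec in ek; unfold Nat.odd in ek.
    destruct (Nat.even k); [discriminate|]; split; assumption.
Qed.

Lemma filterlim_Rplus (F : (R -> Prop) -> Prop) {FF : Filter F} (f g : R -> R) (a b : R) :
  filterlim f F (locally a) -> filterlim g F (locally b) ->
  filterlim (fun x => f x + g x) F (locally (a + b)).
Proof. intros hf hg; eapply filterlim_comp_2; [exact hf|exact hg|exact (filterlim_plus (V := R_NormedModule) a b)]. Qed.

Lemma filterlim_Rmult (F : (R -> Prop) -> Prop) {FF : Filter F} (f g : R -> R) (a b : R) :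
  filterlim f F (locally a) -> filterlim g F (locally b) ->
  filterlim (fun x => f x * g x) F (locally (a * b)).
Proof. intros hf hg; eapply filterlim_comp_2; [exact hf|exact hg|exact (filterlim_mult (K := R_AbsRing) a b)]. Qed.

Lemma at_right_between (a b : R) : a < b -> at_right a (fun x => a < x < b).
Proof.
intros h; unfold at_right, within; apply (filter_imp (fun x => x < b)); [intros x h1 h2; split; assumption|].
apply open_lt, h.
Qed.

Lemma at_left_between (a b : R) : a < b -> at_left b (fun x => a < x < b).
Proof.
intros h; unfold at_left, within; apply (filter_imp (fun x => a < x)); [intros x h1 h2; split; assumption|].
apply open_gt, h.
Qed.

(** * Propagation of a given solution *)

(** The inverse of [layer q e t]. *)
Definition unlayer (q e t : R) : mat2 :=
  Mat (gcos (e * q) t) (- (e * gsin (e * q) t)) (q * gsin (e * q) t) (gcos (e * q) t).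

Lemma mmul_layer_unlayer (q e t : R) : e * q <> 0 ->
  mmul (layer q e t) (unlayer q e t) = mone.
Proof.
intros h; unfold mmul, mone; simpl; f_equal;
  try rewrite <- (gcos_gsin (e * q) t h); ring.
Qed.

(** Propagating a solution back to [x0] gives a conserved state. *)
Lemma is_derive_unlayer (q e x0 x : R) (u p : R -> R) : e * q <> 0 ->
  is_derive u x (e * p x) -> is_derive p x (- q * u x) ->
  is_derive (fun y => fst (mapp (unlayer q e (y - x0)) (u y, p y))) x 0 /\
  is_derive (fun y => snd (mapp (unlayer q e (y - x0)) (u y, p y))) x 0.
Proof.
intros h hu hp; simpl.
pose proof (is_derive_gcos_x (e * q) (x - x0) h) as hC.
pose proof (is_derive_gsin_x (e * q) (x - x0) h) as hS.
split; auto_derive; try (repeat split; eexists; eassumption);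
  rw_derive hC; rw_derive hS; rw_derive hu; rw_derive hp; unfold Rminus; ring.
Qed.

(** Only one-sided limits are available at the interfaces. *)
Lemma constant_between (f : R -> R) (a b fa fb : R) : a < b ->
  (forall x, a < x < b -> is_derive f x 0) ->
  filterlim f (at_right a) (locally fa) -> filterlim f (at_left b) (locally fb) -> fa = fb.
Proof.
intros hab hf ha hb.
set (m := (a + b) / 2).
assert (hc : forall x, a < x < b -> f x = f m).
{ intros x hx; destruct (Rtotal_order x m) as [h|[->|h]]; [|reflexivity|].
  - apply (eq_is_derive f); [intros t ht; apply hf; unfold m in *; lra|exact h].
  - symmetry; apply (eq_is_derive f); [intros t ht; apply hf; unfold m in *; lra|exact h]. }
transitivity (f m).
- apply (filterlim_locally_unique (F := at_right a) f); [exact ha|].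
  apply filterlim_ext_loc with (fun _ => f m); [|apply filterlim_const].
  apply filter_imp with (2 := at_right_between a b hab).
  intros x hx; symmetry; apply hc, hx.
- apply (filterlim_locally_unique (F := at_left b) f); [|exact hb].
  apply filterlim_ext_loc with (fun _ => f m); [|apply filterlim_const].
  apply filter_imp with (2 := at_left_between a b hab).
  intros x hx; symmetry; apply hc, hx.
Qed.

Lemma filterlim_mapp (F : (R -> Prop) -> Prop) {FF : Filter F} (A : R -> mat2)
    (u p : R -> R) (B : mat2) (u0 p0 : R) :
  filterlim (fun x => m11 (A x)) F (locally (m11 B)) ->
  filterlim (fun x => m12 (A x)) F (locally (m12 B)) ->
  filterlim (fun x => m21 (A x)) F (locally (m21 B)) ->
  filterlim (fun x => m22 (A x)) F (locally (m22 B)) ->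
  filterlim u F (locally u0) -> filterlim p F (locally p0) ->
  filterlim (fun x => fst (mapp (A x) (u x, p x))) F (locally (fst (mapp B (u0, p0)))) /\
  filterlim (fun x => snd (mapp (A x) (u x, p x))) F (locally (snd (mapp B (u0, p0)))).
Proof.
intros; split; simpl; apply filterlim_Rplus; try assumption;
  apply filterlim_Rmult; assumption.
Qed.

Lemma continuous_unlayer (q e t : R) : e * q <> 0 -> continuous_mat (unlayer q e) t.
Proof.
intros h.
pose proof (is_derive_continuous _ _ _ (is_derive_gcos_x (e * q) t h)) as hC.
pose proof (is_derive_continuous _ _ _ (is_derive_gsin_x (e * q) t h)) as hS.
mat_split; [exact hC| | |exact hC].
- apply continuous_Ropp, continuous_Rmult; [apply continuous_const|exact hS].
- apply continuous_Rmult; [apply continuous_const|exact hS].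
Qed.

(** Uniqueness for the initial value problem in a layer, from limits at its left
    end to limits at its right end. *)
Lemma layer_propagates (q e a b ua pa ub pb : R) (u p : R -> R) :
  e * q <> 0 -> a < b ->
  (forall x, a < x < b -> is_derive u x (e * p x) /\ is_derive p x (- q * u x)) ->
  filterlim u (at_right a) (locally ua) -> filterlim p (at_right a) (locally pa) ->
  filterlim u (at_left b) (locally ub) -> filterlim p (at_left b) (locally pb) ->
  (ub, pb) = mapp (layer q e (b - a)) (ua, pa).
Proof.
intros h hab hd hua hpa hub hpb.
assert (hA : forall x, continuous_mat (fun y => unlayer q e (y - a)) x).
{ intros x; apply (continuous_mat_comp (unlayer q e) (fun y => y - a));
    [apply continuous_shift|apply continuous_unlayer, h]. }
assert (hr : forall f : R -> R, continuous f a -> filterlim f (at_right a) (locally (f a))).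
{ intros f hf; apply filterlim_filter_le_1 with (2 := hf), filter_le_within. }
assert (hl : forall f : R -> R, continuous f b -> filterlim f (at_left b) (locally (f b))).
{ intros f hf; apply filterlim_filter_le_1 with (2 := hf), filter_le_within. }
destruct (hA a) as (a1 & a2 & a3 & a4); destruct (hA b) as (b1 & b2 & b3 & b4).
destruct (filterlim_mapp (at_right a) (fun y => unlayer q e (y - a)) u p
  (unlayer q e (a - a)) ua pa (hr _ a1) (hr _ a2) (hr _ a3) (hr _ a4) hua hpa) as [A1 A2].
destruct (filterlim_mapp (at_left b) (fun y => unlayer q e (y - a)) u p
  (unlayer q e (b - a)) ub pb (hl _ b1) (hl _ b2) (hl _ b3) (hl _ b4) hub hpb) as [B1 B2].
assert (e1 : mapp (unlayer q e (a - a)) (ua, pa) = mapp (unlayer q e (b - a)) (ub, pb)).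
{ rewrite (surjective_pairing (mapp (unlayer q e (a - a)) _)),
    (surjective_pairing (mapp (unlayer q e (b - a)) _)).
  f_equal; (eapply constant_between; [exact hab| |eassumption|eassumption]);
    intros x hx; destruct (hd x hx) as [hu hp];
    destruct (is_derive_unlayer q e a x u p h hu hp); assumption. }
rewrite <- (mapp_1 (ub, pb)), <- (mmul_layer_unlayer q e (b - a) h), mapp_mmul, <- e1.
f_equal; replace (a - a) with 0 by ring.
unfold mapp; simpl; rewrite gcos_0, gsin_0; f_equal; ring.
Qed.

(** The states at the integers of a solution on the half line; the state at 0 is
    the limit from the right. *)
Lemma half_line_states (c : unit_cell) (q e1 e2 u0 p0 : R) (u p : R -> R) :
  q <> 0 -> e1 <> 0 -> e2 <> 0 ->
  solves_with c q e1 e2 (fun x => 0 < x) u p ->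
  filterlim u (at_right 0) (locally u0) -> filterlim p (at_right 0) (locally p0) ->
  let st x := if Rlt_dec 0 x then (u x, p x) else (u0, p0) in
  forall n : nat, st (INR (S n)) = mapp (cell_matrix c q e1 e2) (st (INR n)).
Proof.
intros hq h1 h2 [hc hd] hu0 hp0 st n.
assert (hle : forall (x : R) (f : R -> R), continuous f x -> filterlim f (at_left x) (locally (f x))).
{ intros x f hf; apply filterlim_filter_le_1 with (2 := hf), filter_le_within. }
assert (hri : forall (x : R) (f : R -> R), continuous f x -> filterlim f (at_right x) (locally (f x))).
{ intros x f hf; apply filterlim_filter_le_1 with (2 := hf), filter_le_within. }
assert (hst : forall x, 0 <= x -> filterlim u (at_right x) (locally (fst (st x))) /\
  filterlim p (at_right x) (locally (snd (st x)))).
{ intros x hx; unfold st; destruct (Rlt_dec 0 x) as [h|h]; simpl.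
  - destruct (hc x h); split; apply hri; assumption.
  - replace x with 0 by lra; split; assumption. }
pose proof (pos_INR n) as hn.
assert (H : forall k, (k <= 2 * npart c + 1)%nat ->
  st (INR n + node c k) = mapp (transfer c q e1 e2 k) (st (INR n))).
{ induction k as [|k IH]; intros hk.
  - rewrite node_first, Rplus_0_r; symmetry; apply mapp_1.
  - change (transfer c q e1 e2 (S k)) with
      (mmul (klayer q e1 e2 k (width c k)) (transfer c q e1 e2 k)).
    rewrite mapp_mmul, <- IH by lia.
    pose proof (node_bounds c k ltac:(lia)) as hk0.
    pose proof (node_incr c k ltac:(lia)) as hk1.
    set (a := INR n + node c k); set (b := INR n + node c (S k)).
    assert (hb : st b = (u b, p b)).
    { unfold st; destruct (Rlt_dec 0 b) as [h|h]; [reflexivity|exfalso; unfold b in h; lra]. }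
    assert (hb0 : 0 < b) by (unfold b; lra).
    rewrite hb, (surjective_pairing (st a)); unfold klayer.
    replace (width c k) with (b - a) by (unfold a, b, width; ring).
    destruct (hst a ltac:(unfold a; lra)); destruct (hc b hb0).
    apply (layer_propagates q _ a b) with (u := u) (p := p);
      [|unfold a, b; lra| |assumption|assumption|apply hle; assumption|apply hle; assumption].
    + destruct (Nat.even k); apply Rmult_integral_contrapositive_currified; assumption.
    + intros x hx; apply (hd (Z.of_nat n) k x); [unfold a in hx; lra|lia|].
      unfold in_particle; rewrite <- INR_IZR_INZ; exact hx. }
rewrite S_INR; rewrite <- (node_last c) at 1; apply H; lia.
Qed.

(** * Hyperbolic transfer matrices and uniqueness of the impedance *)

(** The eigenvalue a - s sqrt (a^2 - 1) of a matrix with diagonal (a, a) and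
    determinant 1; it has modulus less than 1 when [s] is the sign of a and
    |a| > 1. *)
Definition decay_rate (s : R) (T : mat2) : R := m11 T - s * sqrt (m11 T ^ 2 - 1).

(** The ratio u / p on the eigenline of [decay_rate]. *)
Definition zval (s : R) (T : mat2) : R := - (s * sqrt (m11 T ^ 2 - 1)) / m21 T.

(** A matrix with constant diagonal, determinant 1 and eigenvalues off the unit
    circle; [s] is the sign of the diagonal entry. *)
Record hyperbolic (s : R) (T : mat2) : Prop := {
  hyp_sign : s ^ 2 = 1;
  hyp_trace : 1 < s * m11 T;
  hyp_mirror : m11 T = m22 T;
  hyp_det : mdet T = 1 }.

Lemma hyperbolic_facts (s : R) (T : mat2) : hyperbolic s T ->
  let r := sqrt (m11 T ^ 2 - 1) in
  0 < r /\ r ^ 2 = m11 T ^ 2 - 1 /\ m12 T * m21 T = r ^ 2 /\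
  m12 T <> 0 /\ m21 T <> 0 /\
  decay_rate s T * (m11 T + s * r) = 1 /\
  Rabs (decay_rate s T) < 1 /\
  mapp T (zval s T, 1) = (decay_rate s T * zval s T, decay_rate s T * 1).
Proof.
intros [hs ha hm hdet] r; unfold mdet in hdet; rewrite <- hm in hdet.
set (a := m11 T) in *; set (b := m12 T) in *; set (d := m21 T) in *.
assert (hA : a ^ 2 = (s * a) ^ 2) by (rewrite Rpow_mult_distr, hs; ring).
assert (hpos : 0 < a ^ 2 - 1) by (rewrite hA; nra).
assert (hr0 : 0 < r) by (apply sqrt_lt_R0, hpos).
assert (hr2 : r ^ 2 = a ^ 2 - 1) by (unfold r; rewrite pow2_sqrt; lra).
assert (hbd : b * d = r ^ 2) by lra.
assert (hr2' : 0 < r ^ 2) by lra.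
assert (hb : b <> 0) by (intros e; rewrite e in hbd; lra).
assert (hd : d <> 0) by (intros e; rewrite e in hbd; lra).
assert (hlr : decay_rate s T * (a + s * r) = 1).
{ unfold decay_rate; fold a r.
  transitivity (a ^ 2 - s ^ 2 * r ^ 2); [ring|rewrite hs, hr2; ring]. }
repeat split; try assumption.
- assert (hsl : Rabs (decay_rate s T) = Rabs (s * a - r)).
  { assert (hss : Rabs s = 1).
    { apply Rsqr_inj; [apply Rabs_pos|lra|]; rewrite <- Rsqr_abs; unfold Rsqr; lra. }
    rewrite <- (Rmult_1_l (Rabs (decay_rate s T))), <- hss, <- Rabs_mult; f_equal.
    unfold decay_rate; fold a r; transitivity (s * a - s ^ 2 * r); [ring|rewrite hs; ring]. }
  rewrite hsl; apply Rabs_def1; nra.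
- unfold mapp, zval, decay_rate; cbn [fst snd]; fold a b d r; rewrite <- hm; fold a.
  f_equal; [|field; assumption].
  assert (hb' : b = r ^ 2 / d) by (rewrite <- hbd; field; assumption).
  rewrite hb'; transitivity (a * (- (s * r) / d) + s ^ 2 * r ^ 2 / d);
    [rewrite hs|]; field; assumption.
Qed.

(** The left eigenvector of the expanding eigenvalue gives a functional that
    grows along the states; it must vanish on a decaying solution, which
    determines u / p. Decay of u alone suffices, since u at two consecutive
    integers determines p. *)
Lemma decaying_initial_state (s : R) (T : mat2) (st : nat -> R * R) :
  hyperbolic s T -> (forall n, st (S n) = mapp T (st n)) ->
  is_lim_seq (fun n => fst (st n)) 0 ->
  m21 T * fst (st 0%nat) + s * sqrt (m11 T ^ 2 - 1) * snd (st 0%nat) = 0.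
Proof.
intros hT hst hlim.
destruct (hyperbolic_facts s T hT) as (hr0 & hr2 & hbd & hb & hd & hlr & hl1 & _).
destruct hT as [hs _ hm _].
set (r := sqrt (m11 T ^ 2 - 1)) in *.
(* The functional given by the left eigenvector for the eigenvalue a + s r. *)
set (l := fun n => m21 T * fst (st n) + s * r * snd (st n)).
change (l 0%nat = 0).
assert (hl : forall n, l (S n) = (m11 T + s * r) * l n).
{ intros n; unfold l; rewrite hst; unfold mapp; simpl fst; simpl snd; rewrite <- hm.
  transitivity (m21 T * m11 T * fst (st n) + (m12 T * m21 T) * snd (st n)
    + s * r * (m21 T * fst (st n) + m11 T * snd (st n))); [ring|].
  rewrite hbd.
  transitivity (m21 T * m11 T * fst (st n) + s ^ 2 * r ^ 2 * snd (st n)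
    + s * r * (m21 T * fst (st n) + m11 T * snd (st n))); [rewrite hs|]; ring. }
assert (hge : 1 <= Rabs (m11 T + s * r)).
{ assert (e : Rabs (decay_rate s T) * Rabs (m11 T + s * r) = 1)
    by (rewrite <- Rabs_mult, hlr; apply Rabs_R1).
  pose proof (Rabs_pos (decay_rate s T)). pose proof (Rabs_pos (m11 T + s * r)). nra. }
assert (hln : forall n, Rabs (l 0%nat) <= Rabs (l n)).
{ induction n as [|n IH]; [lra|].
  rewrite hl, Rabs_mult; pose proof (Rabs_pos (l n)); nra. }
assert (hl0 : is_lim_seq l 0).
{ (* Here p is eliminated by u (n + 1) = a u n + b p n, with b <> 0.
     *)
  apply (is_lim_seq_ext (fun n => (m21 T - s * r * m11 T / m12 T) * fst (st n)
    + s * r / m12 T * fst (st (S n)))).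
  - intros n; unfold l; rewrite hst; simpl; field; exact hb.
  - replace 0 with ((m21 T - s * r * m11 T / m12 T) * 0 + s * r / m12 T * 0) by ring.
    apply is_lim_seq_plus'; apply (is_lim_seq_scal_l _ _ 0); [exact hlim|].
    apply (is_lim_seq_incr_1 (fun n => fst (st n))), hlim. }
apply is_lim_seq_abs in hl0; simpl in hl0; rewrite Rabs_R0 in hl0.
pose proof (is_lim_seq_le _ _ _ _ hln (is_lim_seq_const (Rabs (l 0%nat))) hl0) as hfin.
simpl in hfin; pose proof (Rabs_pos (l 0%nat)).
destruct (Req_dec (l 0%nat) 0) as [e|ne]; [exact e|].
apply Rabs_pos_lt in ne; lra.
Qed.

Lemma impedance_plus_unique (c : unit_cell) (mu0 e1 e2 w s z : R) :
  mu0 * w ^ 2 <> 0 -> e1 <> 0 -> e2 <> 0 ->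
  hyperbolic s (cell_matrix c (mu0 * w ^ 2) e1 e2) ->
  is_impedance_plus c mu0 e1 e2 w z ->
  z = zval s (cell_matrix c (mu0 * w ^ 2) e1 e2).
Proof.
intros hq h1 h2 hT (u & hsol & _ & hlim & u0 & p0 & hu0 & hp0 & hpn & ->).
assert (hmu : mu0 <> 0) by (intros e; apply hq; rewrite e; ring).
apply solves_R in hsol; [|assumption..]; destruct hsol as [p hsol].
assert (hp : filterlim p (at_right 0) (locally p0)).
{ apply filterlim_ext_loc with (2 := hp0).
  assert (h01 : 0 < node c 1) by (rewrite <- (node_first c) at 1; apply node_incr; lia).
  apply filter_imp with (2 := at_right_between 0 _ h01); intros x hx.
  destruct hsol as [_ hd]; destruct (hd 0%Z 0%nat x) as [hu _]; [lra|lia| |].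
  - unfold in_particle; rewrite node_first; lra.
  - rewrite (is_derive_unique _ _ _ hu); simpl; field; exact h1. }
pose proof (half_line_states c _ e1 e2 u0 p0 u p hq h1 h2 hsol hu0 hp) as hst.
set (st := fun x => if Rlt_dec 0 x then (u x, p x) else (u0, p0)) in hst.
pose proof (decaying_initial_state s _ (fun n => st (INR n)) hT hst) as e.
destruct (hyperbolic_facts s _ hT) as (_ & _ & _ & _ & hd & _).
unfold zval; set (T := cell_matrix c (mu0 * w ^ 2) e1 e2) in *.
assert (hst0 : st (INR 0) = (u0, p0)).
{ unfold st; simpl; destruct (Rlt_dec 0 0); [lra|reflexivity]. }
cbv beta in e; rewrite hst0 in e; simpl fst in e; simpl snd in e.
assert (hseq : is_lim_seq (fun n => fst (st (INR n))) 0).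
{ apply is_lim_seq_ext_loc with (fun n => u (INR n)).
  - exists 1%nat; intros n hn; unfold st; destruct (Rlt_dec 0 (INR n)) as [h|h]; [reflexivity|].
    exfalso; apply h, lt_0_INR; lia.
  - apply (is_lim_comp_seq u INR p_infty 0 hlim); [|apply is_lim_seq_INR].
    exists 0%nat; intros; discriminate. }
specialize (e hseq).
apply Rmult_eq_reg_l with (m21 T * p0);
  [|apply Rmult_integral_contrapositive_currified; assumption].
field_simplify; [|assumption..]. lra.
Qed.

(** * Existence of the impedance *)

Lemma glued_solves (c : unit_cell) (q e1 e2 : R) (v : Z -> R * R) (D : R -> Prop) :
  q <> 0 -> e1 <> 0 -> e2 <> 0 ->
  (forall n, v (n + 1)%Z = mapp (cell_matrix c q e1 e2) (v n)) ->
  solves_with c q e1 e2 D (fun x => fst (glued c q e1 e2 v x))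
    (fun x => snd (glued c q e1 e2 v x)).
Proof.
intros hq h1 h2 hv; split.
- intros x _; apply continuous_glued; assumption.
- intros n k x _ hk hx; apply (is_derive_glued c q e1 e2 hq h1 h2 v n k); assumption.
Qed.

Lemma glued_integer (c : unit_cell) (q e1 e2 : R) (v : Z -> R * R) (n : Z) :
  glued c q e1 e2 v (IZR n) = v n.
Proof.
unfold glued; rewrite (Int_part_eq n) by lra.
rewrite cell_fund_0 by lra; apply mapp_1.
Qed.

(** The first particle has permittivity [e1], so that the one-sided limit of
    u' / e1 is that of the flux; likewise for the last particle in [flux_at_left]. *)
Lemma flux_at_right (c : unit_cell) (q e1 e2 l : R) (u p : R -> R) : e1 <> 0 ->
  solves_with c q e1 e2 (fun x => 0 < x) u p ->
  (filterlim (fun x => / e1 * Derive u x) (at_right 0) (locally l) <->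
   filterlim p (at_right 0) (locally l)).
Proof.
intros h1 [_ hd].
assert (h01 : 0 < node c 1) by (rewrite <- (node_first c) at 1; apply node_incr; lia).
assert (he : at_right 0 (fun x => / e1 * Derive u x = p x)).
{ apply filter_imp with (2 := at_right_between 0 _ h01); intros x hx.
  destruct (hd 0%Z 0%nat x) as [hu _]; [lra|lia| |].
  - unfold in_particle; rewrite node_first; lra.
  - rewrite (is_derive_unique _ _ _ hu); simpl; field; exact h1. }
split; apply filterlim_ext_loc; [exact he|].
apply filter_imp with (2 := he); intros; symmetry; assumption.
Qed.

Lemma flux_at_left (c : unit_cell) (q e1 e2 l : R) (u p : R -> R) : e1 <> 0 ->
  solves_with c q e1 e2 (fun x => x < 0) u p ->
  (filterlim (fun x => / e1 * Derive u x) (at_left 0) (locally l) <->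
   filterlim p (at_left 0) (locally l)).
Proof.
intros h1 [_ hd].
set (m := (2 * npart c)%nat).
assert (h01 : -1 + node c m < 0).
{ pose proof (node_incr c m ltac:(unfold m; lia)) as h.
  replace (S m) with (2 * npart c + 1)%nat in h by (unfold m; lia).
  rewrite node_last in h; lra. }
assert (he : at_left 0 (fun x => / e1 * Derive u x = p x)).
{ apply filter_imp with (2 := at_left_between _ 0 h01); intros x hx.
  destruct (hd (-1)%Z m x) as [hu _]; [lra|unfold m; lia| |].
  - unfold in_particle; replace (S m) with (2 * npart c + 1)%nat by (unfold m; lia).
    rewrite node_last; lra.
  - rewrite (is_derive_unique _ _ _ hu).
    unfold m; rewrite Nat.even_mul; simpl; field; exact h1. }
split; apply filterlim_ext_loc; [exact he|].
apply filter_imp with (2 := he); intros; symmetry; assumption.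
Qed.

(** The solution with states l^n (Z, 1) at the integers, where l is the decay
    rate, decays at +oo and realises the impedance. *)
Lemma impedance_plus_exists (c : unit_cell) (mu0 e1 e2 w s : R) :
  mu0 * w ^ 2 <> 0 -> e1 <> 0 -> e2 <> 0 ->
  hyperbolic s (cell_matrix c (mu0 * w ^ 2) e1 e2) ->
  is_impedance_plus c mu0 e1 e2 w (zval s (cell_matrix c (mu0 * w ^ 2) e1 e2)).
Proof.
intros hq h1 h2 hT.
assert (hmu : mu0 <> 0) by (intros e; apply hq; rewrite e; ring).
destruct (hyperbolic_facts s _ hT) as (hr & _ & _ & _ & hd & hlr & hl1 & hTz).
pose proof (hyp_sign _ _ hT) as hs.
set (q := mu0 * w ^ 2) in *; set (T := cell_matrix c q e1 e2) in *.
set (l := decay_rate s T) in *; set (z := zval s T) in *.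
assert (hl0 : l <> 0) by (intros e; rewrite e in hlr; lra).
assert (hz0 : z <> 0).
{ unfold z, zval; apply Rmult_integral_contrapositive_currified;
    [|apply Rinv_neq_0_compat, hd].
  apply Ropp_neq_0_compat, Rmult_integral_contrapositive_currified; [|lra].
  intros e; rewrite e in hs; lra. }
set (v := fun n : Z => (powerRZ l n * z, powerRZ l n * 1)).
assert (hv : forall n, v (n + 1)%Z = mapp (cell_matrix c q e1 e2) (v n)).
{ intros n; unfold v; rewrite powerRZ_add, powerRZ_1 by exact hl0.
  transitivity (powerRZ l n * fst (mapp T (z, 1)), powerRZ l n * snd (mapp T (z, 1))).
  - rewrite hTz; cbn [fst snd]; f_equal; ring.
  - unfold mapp; cbn [fst snd]; fold T; f_equal; ring. }
pose proof (glued_solves c q e1 e2 v (fun x => 0 < x) hq h1 h2 hv) as hsol.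
destruct (continuous_glued c q e1 e2 hq h1 h2 v hv 0) as [hu0 hp0].
assert (hr0 : forall f : R -> R, continuous f 0 -> filterlim f (at_right 0) (locally (f 0))).
{ intros f hf; apply filterlim_filter_le_1 with (2 := hf), filter_le_within. }
set (u := fun x => fst (glued c q e1 e2 v x)) in *.
set (p := fun x => snd (glued c q e1 e2 v x)) in *.
apply hr0 in hu0; apply hr0 in hp0.
assert (e0 : glued c q e1 e2 v 0 = (1 * z, 1 * 1)) by (apply (glued_integer c q e1 e2 v 0)).
assert (eu0 : u 0 = 1 * z) by (unfold u; rewrite e0; reflexivity).
assert (ep0 : p 0 = 1 * 1) by (unfold p; rewrite e0; reflexivity).
change (filterlim u (at_right 0) (locally (u 0))) in hu0; rewrite eu0 in hu0.
change (filterlim p (at_right 0) (locally (p 0))) in hp0; rewrite ep0 in hp0.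
exists u; split; [|split; [|split]].
- apply solves_R; [assumption..|]; exists p; exact hsol.
- exists 1; split; [lra|].
  unfold u; rewrite (glued_integer c q e1 e2 v 1); unfold v; cbn [fst]; rewrite powerRZ_1.
  apply Rmult_integral_contrapositive_currified; assumption.
- set (g := fun y => Rabs (fst (mapp (cell_fund c q e1 e2 y) (z, 1)))).
  (* [u] is at most [K] times the n-th power of |l| on the n-th cell. *)
  destruct (continuity_ab_maj g 0 1) as [y0 [hK _]]; [lra| |].
  { intros y _; apply continuity_pt_filterlim.
    apply (continuous_comp (fun y => fst (mapp (cell_fund c q e1 e2 y) (z, 1))) Rabs);
      [|apply continuous_Rabs].
    refine (proj1 (continuous_mapp (cell_fund c q e1 e2) (fun _ => (z, 1)) y _ _ _));
      [apply continuous_cell_fund; assumption|apply continuous_const|apply continuous_const]. }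
  set (K := g y0) in hK.
  assert (hK0 : 0 <= K) by apply Rabs_pos.
  apply is_lim_spec; intros eps; simpl.
  destruct (pow_lt_1_zero l hl1 (eps / (K + 1))) as [N hN].
  { apply Rdiv_lt_0_compat; [apply cond_pos|lra]. }
  exists (INR N); intros x hx.
  destruct (base_Int_part x) as [b1 b2].
  pose proof (pos_INR N) as hNpos.
  assert (hn : (Z.of_nat N <= Int_part x)%Z).
  { apply Z.lt_succ_r, lt_IZR; rewrite succ_IZR, <- INR_IZR_INZ; lra. }
  set (m := Z.to_nat (Int_part x)).
  assert (hm : Int_part x = Z.of_nat m) by (unfold m; lia).
  specialize (hN m ltac:(lia)).
  assert (hux : u x = l ^ m * fst (mapp (cell_fund c q e1 e2 (x - IZR (Int_part x))) (z, 1))).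
  { unfold u, glued, v; rewrite hm at 2 3; rewrite <- pow_powerRZ; simpl; ring. }
  rewrite hux, Rminus_0_r, Rabs_mult.
  (* The position within the cell lies between 0 and 1. *)
  assert (hg : Rabs (fst (mapp (cell_fund c q e1 e2 (x - IZR (Int_part x))) (z, 1))) <= K)
    by (apply (hK (x - IZR (Int_part x))); lra).
  apply Rle_lt_trans with (Rabs (l ^ m) * K).
  { apply Rmult_le_compat_l; [apply Rabs_pos|exact hg]. }
  apply Rle_lt_trans with (Rabs (l ^ m) * (K + 1)).
  { apply Rmult_le_compat_l; [apply Rabs_pos|lra]. }
  apply Rmult_lt_reg_r with (/ (K + 1)); [apply Rinv_0_lt_compat; lra|].
  rewrite Rmult_assoc, Rinv_r, Rmult_1_r by lra; exact hN.
- exists (1 * z), (1 * 1); split; [exact hu0|split; [|split; [lra|field]]].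
  apply (flux_at_right c q e1 e2 _ u p h1 hsol), hp0.
Qed.

Lemma impedance_plus_eq (c : unit_cell) (mu0 w s : R) (eps1 eps2 : R -> R) :
  mu0 * w ^ 2 <> 0 -> eps1 w <> 0 -> eps2 w <> 0 ->
  hyperbolic s (cell_matrix c (mu0 * w ^ 2) (eps1 w) (eps2 w)) ->
  impedance_plus c mu0 eps1 eps2 w = zval s (cell_matrix c (mu0 * w ^ 2) (eps1 w) (eps2 w)).
Proof.
intros hq h1 h2 hT.
apply (iota_unique (V := R_CompleteNormedModule)).
- intros z hz; apply impedance_plus_unique with (5 := hz); assumption.
- apply impedance_plus_exists; assumption.
Qed.

(** * Reflection of the half line *)

(** The unit cell being mirror symmetric, u(-x) solves the equation in the same
    medium, with flux -p(-x). *)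
Lemma solves_with_reflect (c : unit_cell) (q e1 e2 : R) (D : R -> Prop) (u p : R -> R) :
  solves_with c q e1 e2 D u p ->
  solves_with c q e1 e2 (fun x => D (- x)) (fun x => u (- x)) (fun x => - p (- x)).
Proof.
intros [hc hd]; split.
- intros x hx; destruct (hc _ hx) as [hu hp].
  assert (ho : continuous Ropp x) by apply (continuous_opp (fun x : R => x)), continuous_id.
  split; [|apply continuous_Ropp].
  + exact (continuous_comp Ropp u x ho hu).
  + exact (continuous_comp Ropp p x ho hp).
- intros n k x hx hk hxk.
  destruct (hd (- n - 1)%Z (2 * npart c - k)%nat (- x) hx ltac:(lia)) as [hu hp].
  { unfold in_particle in *; rewrite minus_IZR, opp_IZR.
    replace (S (2 * npart c - k)) with (2 * npart c + 1 - k)%nat by lia.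
    replace (2 * npart c - k)%nat with (2 * npart c + 1 - S k)%nat by lia.
    rewrite !node_mirror by lia; lra. }
  assert (ek : Nat.even (2 * npart c - k) = Nat.even k).
  { rewrite Nat.even_sub by lia; rewrite Nat.even_mul; simpl; destruct (Nat.even k); reflexivity. }
  rewrite ek in hu.
  split; auto_derive; try (eexists; eassumption);
    [rw_derive hu|rw_derive hp]; ring.
Qed.

Lemma filterlim_reflect_left (f : R -> R) (l : R) :
  filterlim f (at_left 0) (locally l) -> filterlim (fun x => f (- x)) (at_right 0) (locally l).
Proof.
intros h; apply (filterlim_comp _ _ _ Ropp f _ (at_left 0)); [|exact h].
rewrite <- Ropp_0 at 2; apply filterlim_Ropp_right.
Qed.

Lemma filterlim_reflect_right (f : R -> R) (l : R) :
  filterlim f (at_right 0) (locally l) -> filterlim (fun x => f (- x)) (at_left 0) (locally l).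
Proof.
intros h; apply (filterlim_comp _ _ _ Ropp f _ (at_right 0)); [|exact h].
rewrite <- Ropp_0 at 2; apply filterlim_Ropp_left.
Qed.

Lemma is_lim_reflect (f : R -> R) (x l : Rbar) :
  is_lim f x l -> is_lim (fun y => f (- y)) (Rbar_opp x) l.
Proof.
intros h; apply (is_lim_comp f Ropp _ l x h).
- rewrite <- (Rbar_opp_involutive x) at 2; apply is_lim_opp, is_lim_id.
- destruct x as [x| |]; simpl; [|exists 0; intros; discriminate..].
  exists (mkposreal 1 Rlt_0_1); intros y _ hy e; apply hy.
  injection e; intros; lra.
Qed.

Lemma impedance_minus_iff_plus (c : unit_cell) (mu0 e1 e2 w z : R) :
  mu0 <> 0 -> e1 <> 0 -> e2 <> 0 ->
  is_impedance_minus c mu0 e1 e2 w z <-> is_impedance_plus c mu0 e1 e2 w z.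
Proof.
intros hmu h1 h2; split;
  intros (u & hsol & (x & hx & hux) & hlim & u0 & p0 & hu0 & hp0 & hpn & ->);
  (apply solves_R in hsol; [|assumption..]); destruct hsol as [p hsol];
  pose proof (solves_with_reflect _ _ _ _ _ _ _ hsol) as hsol'.
- assert (hs : solves_with c (mu0 * w ^ 2) e1 e2 (fun x => 0 < x) (fun x => u (- x)) (fun x => - p (- x))).
  { destruct hsol' as [a b]; split; intros; [apply a|eapply b; try eassumption]; lra. }
  exists (fun x => u (- x)); split; [|split; [|split]].
  + apply solves_R; [assumption..|]; exists (fun x => - p (- x)); exact hs.
  + exists (- x); split; [lra|rewrite Ropp_involutive; exact hux].
  + apply (is_lim_reflect u m_infty), hlim.
  + exists u0, (- p0); split; [apply filterlim_reflect_left, hu0|].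
    split; [|split; [lra|field; lra]].
    apply (flux_at_right _ _ _ _ _ _ _ h1 hs).
    apply (flux_at_left _ _ _ _ _ _ _ h1 hsol), filterlim_reflect_left in hp0.
    exact (filterlim_comp _ _ _ _ _ _ _ _ hp0 (filterlim_opp (V := R_NormedModule) p0)).
- assert (hs : solves_with c (mu0 * w ^ 2) e1 e2 (fun x => x < 0) (fun x => u (- x)) (fun x => - p (- x))).
  { destruct hsol' as [a b]; split; intros; [apply a|eapply b; try eassumption]; lra. }
  exists (fun x => u (- x)); split; [|split; [|split]].
  + apply solves_R; [assumption..|]; exists (fun x => - p (- x)); exact hs.
  + exists (- x); split; [lra|rewrite Ropp_involutive; exact hux].
  + apply (is_lim_reflect u p_infty), hlim.
  + exists u0, (- p0); split; [apply filterlim_reflect_right, hu0|].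
    split; [|split; [lra|field; lra]].
    apply (flux_at_left _ _ _ _ _ _ _ h1 hs).
    apply (flux_at_right _ _ _ _ _ _ _ h1 hsol), filterlim_reflect_right in hp0.
    exact (filterlim_comp _ _ _ _ _ _ _ _ hp0 (filterlim_opp (V := R_NormedModule) p0)).
Qed.

Lemma impedance_minus_eq (c : unit_cell) (mu0 w s : R) (eps1 eps2 : R -> R) :
  mu0 * w ^ 2 <> 0 -> eps1 w <> 0 -> eps2 w <> 0 ->
  hyperbolic s (cell_matrix c (mu0 * w ^ 2) (eps1 w) (eps2 w)) ->
  impedance_minus c mu0 eps1 eps2 w = zval s (cell_matrix c (mu0 * w ^ 2) (eps1 w) (eps2 w)).
Proof.
intros hq h1 h2 hT.
assert (hmu : mu0 <> 0) by (intros e; apply hq; rewrite e; ring).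
apply (iota_unique (V := R_CompleteNormedModule)).
- intros z hz; apply impedance_minus_iff_plus in hz; [|assumption..].
  apply impedance_plus_unique with (5 := hz); assumption.
- apply impedance_minus_iff_plus; [assumption..|].
  apply impedance_plus_exists; assumption.
Qed.

(** * Bloch solutions at frequencies with an elliptic transfer matrix *)

Lemma is_derive_C (f g : R -> R) (x l m : R) :
  is_derive f x l -> is_derive g x m ->
  is_derive (V := C_R_NormedModule) (fun y => (f y, g y)) x (l, m).
Proof.
intros hf hg.
apply (filterdiff_comp'_2 (V := R_NormedModule) (W := prod_NormedModule R_AbsRing R_NormedModule R_NormedModule)
  f g (fun a b => (a, b)) x _ _ (fun a b => (a, b)) hf hg).
apply (filterdiff_ext (fun t => t)); [intros [a b]; reflexivity|].
apply (filterdiff_ext_lin _ (fun t => t)); [apply filterdiff_id|intros [a b]; reflexivity].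
Qed.

Lemma continuous_C (f g : R -> R) (x : R) : continuous f x -> continuous g x ->
  continuous (U := C_R_NormedModule) (fun y => (f y, g y)) x.
Proof.
intros hf hg.
apply (continuous_comp_2 f g (fun a b => (a, b) : prod_UniformSpace R_UniformSpace R_UniformSpace) x hf hg).
apply (continuous_ext (fun t => t)); [intros [a b]; reflexivity|apply continuous_id].
Qed.

Lemma solves_C (c : unit_cell) (mu0 e1 e2 w : R) (D : R -> Prop) (u1 p1 u2 p2 : R -> R) :
  mu0 <> 0 -> e1 <> 0 -> e2 <> 0 ->
  solves_with c (mu0 * w ^ 2) e1 e2 D u1 p1 -> solves_with c (mu0 * w ^ 2) e1 e2 D u2 p2 ->
  solves (V := C_R_NormedModule) c mu0 e1 e2 w D (fun x => (u1 x, u2 x)).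
Proof.
intros hmu h1 h2 [c1 d1] [c2 d2]; exists (fun x => (p1 x, p2 x)); intros x hx.
destruct (c1 x hx), (c2 x hx).
split; [apply continuous_C; assumption|split; [apply continuous_C; assumption|]].
assert (Heq : forall n k, (k < 2 * npart c + 1)%nat -> in_particle c n k x ->
  equation_at (V := C_R_NormedModule) mu0 (if Nat.even k then e1 else e2) w
    (fun x => (u1 x, u2 x)) (fun x => (p1 x, p2 x)) x).
{ intros n k hk hxk.
  destruct (d1 n k x hx hk hxk) as [a b], (d2 n k x hx hk hxk) as [a' b'].
  eexists; eexists; split; [apply is_derive_C; eassumption|].
  split; [|split; [apply is_derive_C; eassumption|]];
    apply injective_projections; unfold scal; simpl; unfold scal; simpl; unfold mult; simpl;
    destruct (Nat.even k); field; assumption. }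
split; intros (n & k & hk & ek & hxk); specialize (Heq n k hk hxk).
- rewrite (proj2 (Nat.even_spec k) ek) in Heq; exact Heq.
- apply Nat.odd_spec in ek; unfold Nat.odd in ek.
  destruct (Nat.even k); [discriminate|exact Heq].
Qed.

(** A solution that vanishes identically has zero flux in the first particle,
    hence a zero state at the origin. *)
Lemma glued_zero (c : unit_cell) (q e1 e2 : R) (v : Z -> R * R) :
  q <> 0 -> e1 <> 0 -> e2 <> 0 ->
  (forall n, v (n + 1)%Z = mapp (cell_matrix c q e1 e2) (v n)) ->
  (forall x, fst (glued c q e1 e2 v x) = 0) -> v 0%Z = (0, 0).
Proof.
intros hq h1 h2 hv h.
rewrite <- (glued_integer c q e1 e2 v 0), (surjective_pairing (glued _ _ _ _ _ _)).
f_equal; [apply h|].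
destruct (continuous_glued c q e1 e2 hq h1 h2 v hv 0) as [_ hp].
apply (filterlim_locally_unique (F := at_right 0) (fun x => snd (glued c q e1 e2 v x))).
- apply filterlim_filter_le_1 with (2 := hp), filter_le_within.
- apply filterlim_ext_loc with (fun _ => 0); [|apply filterlim_const].
  assert (h01 : 0 < node c 1) by (rewrite <- (node_first c) at 1; apply node_incr; lia).
  apply filter_imp with (2 := at_right_between 0 _ h01); intros x hx.
  destruct (is_derive_glued c q e1 e2 hq h1 h2 v 0 0 x) as [hd _]; [lia| |].
  { unfold in_particle; rewrite node_first; lra. }
  apply Rmult_eq_reg_l with e1; [|exact h1]; rewrite Rmult_0_r.
  cbn [Nat.even] in hd; cbv beta; rewrite <- (is_derive_unique _ _ _ hd); symmetry.
  apply is_derive_unique, (is_derive_ext (fun _ => 0));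
    [intros; symmetry; apply h|exact (is_derive_const (0 : R) x)].
Qed.

(** If the diagonal entry a of the cell matrix satisfies |a| <= 1, an eigenvector
    for exp (i kappa), with cos kappa = a, generates a Bloch solution. *)
Lemma elliptic_in_bands (c : unit_cell) (mu0 w : R) (eps1 eps2 : R -> R) :
  mu0 * w ^ 2 <> 0 -> eps1 w <> 0 -> eps2 w <> 0 ->
  -1 <= m11 (cell_matrix c (mu0 * w ^ 2) (eps1 w) (eps2 w)) <= 1 ->
  bands c mu0 eps1 eps2 w.
Proof.
intros hq h1 h2.
pose proof (mdet_cell_matrix c _ _ _ hq h1 h2) as hdet.
pose proof (cell_matrix_mirror c (mu0 * w ^ 2) (eps1 w) (eps2 w)) as hm.
assert (hmu : mu0 <> 0) by (intros e; apply hq; rewrite e; ring).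
set (q := mu0 * w ^ 2) in *; set (e1 := eps1 w) in *; set (e2 := eps2 w) in *.
set (T := cell_matrix c q e1 e2) in *; intros ha.
set (k := acos (m11 T)).
assert (hc : cos k = m11 T) by (apply cos_acos, ha).
assert (hs : sin k ^ 2 = - (m12 T * m21 T)).
{ pose proof (sin2_cos2 k) as h; unfold Rsqr in h; rewrite hc in h.
  unfold mdet in hdet; rewrite <- hm in hdet; lra. }
(* Real and imaginary parts of an eigenvector for exp (i k): (b, i sin k) if b <> 0;
   if b = 0 then sin k = 0 and (0, 1) is one. *)
assert (hv : exists vR vI : R * R, (vR <> (0, 0)) /\
  mapp T vR = (cos k * fst vR - sin k * fst vI, cos k * snd vR - sin k * snd vI) /\
  mapp T vI = (sin k * fst vR + cos k * fst vI, sin k * snd vR + cos k * snd vI)).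
{ unfold mapp; rewrite <- hm, hc; destruct (Req_dec (m12 T) 0) as [e|ne].
  - exists (0, 1), (0, 0); cbn [fst snd].
    assert (hs0 : sin k = 0).
    { apply Rsqr_0_uniq; unfold Rsqr; transitivity (sin k ^ 2); [ring|rewrite hs, e; ring]. }
    rewrite hs0, e; repeat split; [intros h; injection h; lra|f_equal; ring..].
  - exists (m12 T, 0), (0, sin k); cbn [fst snd].
    split; [intros h; injection h; intros; contradiction|].
    split; f_equal; try ring.
    transitivity (- (sin k ^ 2)); [rewrite hs; ring|ring]. }
destruct hv as (vR & vI & hvR & hTR & hTI).
(* Real and imaginary parts of exp (i k n) (vR + i vI). *)
set (gR := fun n : Z => (cos (k * IZR n) * fst vR - sin (k * IZR n) * fst vI,
   cos (k * IZR n) * snd vR - sin (k * IZR n) * snd vI)).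
set (gI := fun n : Z => (sin (k * IZR n) * fst vR + cos (k * IZR n) * fst vI,
   sin (k * IZR n) * snd vR + cos (k * IZR n) * snd vI)).
assert (hlin : forall a b : R, mapp T (a * fst vR + b * fst vI, a * snd vR + b * snd vI) =
  (a * fst (mapp T vR) + b * fst (mapp T vI), a * snd (mapp T vR) + b * snd (mapp T vI))).
{ intros a b; unfold mapp; cbn [fst snd]; f_equal; ring. }
assert (hgR : forall n, gR (n + 1)%Z = mapp T (gR n)).
{ intros n; unfold gR; rewrite plus_IZR, Rmult_plus_distr_l, Rmult_1_r, cos_plus, sin_plus.
  pose proof (hlin (cos (k * IZR n)) (- sin (k * IZR n))) as h.
  rewrite hTR, hTI in h; cbn [fst snd] in h.
  etransitivity; [|etransitivity; [symmetry; exact h|]]; [f_equal; ring|].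
  f_equal; f_equal; ring. }
assert (hgI : forall n, gI (n + 1)%Z = mapp T (gI n)).
{ intros n; unfold gI; rewrite plus_IZR, Rmult_plus_distr_l, Rmult_1_r, cos_plus, sin_plus.
  pose proof (hlin (sin (k * IZR n)) (cos (k * IZR n))) as h.
  rewrite hTR, hTI in h; cbn [fst snd] in h.
  rewrite h; f_equal; ring. }
exists k; split; [pose proof (acos_bound (m11 T)); fold k in H; lra|].
exists (fun x => (fst (glued c q e1 e2 gR x), fst (glued c q e1 e2 gI x))).
split; [|split].
- eapply solves_C; try assumption; apply glued_solves; assumption.
- apply not_all_not_ex; intros hall.
  apply hvR; transitivity (gR 0%Z).
  + unfold gR; rewrite Rmult_0_r, cos_0, sin_0; destruct vR; cbn [fst snd]; f_equal; ring.
  + apply (glued_zero c q e1 e2 gR); try assumption.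
    intros x; specialize (hall x); apply NNPP in hall.
    exact (f_equal fst hall).
- intros x.
  assert (hI : Int_part (x + 1) = (Int_part x + 1)%Z).
  { apply Int_part_eq; rewrite plus_IZR; destruct (base_Int_part x); lra. }
  unfold glued; rewrite hI, plus_IZR.
  replace (x + 1 - (IZR (Int_part x) + 1)) with (x - IZR (Int_part x)) by ring.
  set (n := Int_part x); unfold gR, gI; rewrite plus_IZR, Rmult_plus_distr_l, Rmult_1_r, cos_plus, sin_plus.
  unfold Cmult, mapp; cbn [fst snd]; f_equal; ring.
Qed.

(** The other alternative for the cell matrix is excluded by [elliptic_in_bands]. *)
Lemma gap_hyperbolic (c : unit_cell) (mu0 w : R) (eps1 eps2 : R -> R) :
  mu0 * w ^ 2 <> 0 -> eps1 w <> 0 -> eps2 w <> 0 ->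
  ~ bands c mu0 eps1 eps2 w ->
  exists s, hyperbolic s (cell_matrix c (mu0 * w ^ 2) (eps1 w) (eps2 w)).
Proof.
intros hq h1 h2 hb.
pose proof (mdet_cell_matrix c _ _ _ hq h1 h2) as hdet.
pose proof (cell_matrix_mirror c (mu0 * w ^ 2) (eps1 w) (eps2 w)) as hm.
destruct (Rlt_or_le 1 (m11 (cell_matrix c (mu0 * w ^ 2) (eps1 w) (eps2 w)))) as [h|h].
- exists 1; split; try assumption; lra.
- destruct (Rlt_or_le (m11 (cell_matrix c (mu0 * w ^ 2) (eps1 w) (eps2 w))) (-1)) as [h'|h'].
  + exists (-1); split; try assumption; lra.
  + exfalso; apply hb, elliptic_in_bands; try assumption; lra.
Qed.

(** * Frequency derivative of the impedance *)

(** The frequency derivative of [klayer]. *)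
Definition dklayer (q dq e1 de1 e2 de2 : R) (k : nat) (x : R) : mat2 :=
  dlayer q dq (if Nat.even k then e1 else e2) (if Nat.even k then de1 else de2) x.

(** The frequency derivative of [cell_matrix]. *)
Definition dcell_matrix (c : unit_cell) (q dq e1 de1 e2 de2 : R) : mat2 :=
  dmprod (fun k => klayer q e1 e2 k (width c k))
    (fun k => dklayer q dq e1 de1 e2 de2 k (width c k)) (2 * npart c + 1).

Lemma is_derive_cell_matrix (c : unit_cell) (q e1 e2 : R -> R) (w dq de1 de2 : R) :
  q w <> 0 -> e1 w <> 0 -> e2 w <> 0 ->
  is_derive q w dq -> is_derive e1 w de1 -> is_derive e2 w de2 ->
  is_derive_mat (fun t => cell_matrix c (q t) (e1 t) (e2 t)) w
    (dcell_matrix c (q w) dq (e1 w) de1 (e2 w) de2).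
Proof.
intros hq h1 h2 dq' d1 d2.
apply (is_derive_mat_mprod (fun k t => klayer (q t) (e1 t) (e2 t) k (width c k))
  (fun k => dklayer (q w) dq (e1 w) de1 (e2 w) de2 k (width c k))).
intros k; unfold klayer, dklayer; destruct (Nat.even k); apply is_derive_mat_layer;
  try assumption; apply Rmult_integral_contrapositive_currified; assumption.
Qed.

Lemma skew_dcell_matrix_neg (c : unit_cell) (q dq e1 de1 e2 de2 : R) (v : R * R) :
  q <> 0 -> e1 <> 0 -> e2 <> 0 -> 0 < dq -> 0 <= de1 -> 0 <= de2 -> v <> (0, 0) ->
  skew (cell_matrix c q e1 e2) (dcell_matrix c q dq e1 de1 e2 de2) v < 0.
Proof.
intros hq h1 h2 hdq hd1 hd2 hv.
unfold cell_matrix, dcell_matrix, transfer; rewrite Nat.add_1_r.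
apply skew_dmprod_neg; [intros; apply mdet_klayer; assumption|exact hv|].
intros k u hk hu; unfold klayer, dklayer; destruct (Nat.even k); apply skew_layer_neg;
  try assumption;
  try (apply Rmult_integral_contrapositive_currified; assumption); apply width_pos; lia.
Qed.

(** Used with [t] the perturbation parameter: [q] is fixed, and the permittivity
    and its frequency derivative vary. *)
Lemma continuous_dlayer (q dq x t : R) (e de : R -> R) : e t * q <> 0 ->
  continuous_mat (fun y => layer q (e y) x) t -> continuous e t -> continuous de t ->
  continuous_mat (fun y => dlayer q dq (e y) (de y) x) t.
Proof.
intros h (hC & hS' & hS & _) he hde; simpl in *.
assert (hq0 : q <> 0) by (intros e0; apply h; rewrite e0; ring).
assert (hk : forall r : R, continuous (fun _ : R => r) t) by (intros; apply continuous_const).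
assert (hgS : continuous (fun y => gsin (e y * q) x) t).
{ apply (continuous_ext (fun y => - / q * - (q * gsin (e y * q) x))).
  - intros y; lazymatch goal with |- ?a = ?b => change (a = b :> R) end; field; exact hq0.
  - apply continuous_Rmult; [apply hk|exact hS]. }
assert (hz : continuous (fun y => de y * q + e y * dq) t).
{ apply continuous_Rplus; apply continuous_Rmult; (assumption || apply hk). }
assert (hdC : continuous (fun y => - (x * gsin (e y * q) x / 2) * (de y * q + e y * dq)) t).
{ apply continuous_Rmult; [apply continuous_Ropp|exact hz].
  apply continuous_Rmult; [apply continuous_Rmult; [apply hk|exact hgS]|apply hk]. }
assert (hdS : continuous (fun y => (x * gcos (e y * q) x - gsin (e y * q) x) /
  (2 * (e y * q)) * (de y * q + e y * dq)) t).
{ apply continuous_Rmult; [|exact hz].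
  apply continuous_Rdiv; [lra| |].
  - apply continuous_Rplus; [apply continuous_Rmult; [apply hk|exact hC]|apply continuous_Ropp, hgS].
  - apply continuous_Rmult; [apply hk|apply continuous_Rmult; [exact he|apply hk]]. }
mat_split; [exact hdC| | |exact hdC].
- apply continuous_Rplus; apply continuous_Rmult; assumption.
- apply continuous_Ropp, continuous_Rplus; apply continuous_Rmult; (assumption || apply hk).
Qed.

Lemma continuous_cell_matrices (c : unit_cell) (q dq t : R) (e1 de1 e2 de2 : R -> R) :
  q <> 0 -> e1 t <> 0 -> e2 t <> 0 ->
  ex_derive e1 t -> continuous de1 t -> ex_derive e2 t -> continuous de2 t ->
  continuous_mat (fun y => cell_matrix c q (e1 y) (e2 y)) t /\
  continuous_mat (fun y => dcell_matrix c q dq (e1 y) (de1 y) (e2 y) (de2 y)) t.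
Proof.
intros hq h1 h2 [l1 d1] hde1 [l2 d2] hde2.
assert (hk : forall k, continuous_mat (fun y => klayer q (e1 y) (e2 y) k (width c k)) t).
{ intros k; unfold klayer; destruct (Nat.even k).
  - eapply is_derive_mat_continuous, (is_derive_mat_layer (fun _ => q) e1);
      [apply Rmult_integral_contrapositive_currified; assumption| |exact d1].
    exact (is_derive_const q t).
  - eapply is_derive_mat_continuous, (is_derive_mat_layer (fun _ => q) e2);
      [apply Rmult_integral_contrapositive_currified; assumption| |exact d2].
    exact (is_derive_const q t). }
split.
- apply (continuous_mat_mprod (fun k y => klayer q (e1 y) (e2 y) k (width c k))), hk.
- apply (continuous_mat_dmprod (fun k y => klayer q (e1 y) (e2 y) k (width c k))
    (fun k y => dklayer q dq (e1 y) (de1 y) (e2 y) (de2 y) k (width c k))); [exact hk|].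
  intros k; specialize (hk k); unfold klayer in hk; unfold dklayer.
  destruct (Nat.even k); apply continuous_dlayer; try assumption;
    try (apply Rmult_integral_contrapositive_currified; assumption);
    eapply is_derive_continuous; eassumption.
Qed.

(** The derivative of [zval s] along a curve through [T] with derivative [D]. *)
Definition dzval (s : R) (T D : mat2) : R :=
  s * sqrt (m11 T ^ 2 - 1) * m21 D / m21 T ^ 2
  - s * (m11 T * m11 D) / (sqrt (m11 T ^ 2 - 1) * m21 T).

Lemma is_derive_zval (s w : R) (F : R -> mat2) (D : mat2) :
  is_derive_mat F w D -> 0 < m11 (F w) ^ 2 - 1 -> m21 (F w) <> 0 ->
  is_derive (fun x => zval s (F x)) w (dzval s (F w) D).
Proof.
intros (ha & _ & hc & _) hpos hc0; unfold zval, dzval.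
set (a := fun x => m11 (F x)) in *; set (g := fun x => m21 (F x)) in *.
apply (is_derive_ext (fun x => - (s * sqrt (a x ^ 2 - 1)) / g x)); [reflexivity|].
change (0 < a w ^ 2 - 1) in hpos; change (g w <> 0) in hc0.
change (m11 (F w)) with (a w); change (m21 (F w)) with (g w).
pose proof (sqrt_neq_0 _ hpos) as hr.
auto_derive.
- simpl in hpos; repeat split; try (eexists; eassumption); assumption.
- rw_derive ha; rw_derive hc.
  replace (a w * (a w * 1) + - (1)) with (a w ^ 2 - 1) by ring.
  field; split; assumption.
Qed.

(** On the eigenvector (Z, 1), of eigenvalue l, the skew form equals
    (1 - l^2) dZ. The hypotheses on [D] are the derivatives of the identities
    m11 = m22 and det = 1. *)
Lemma dzval_neg (s : R) (T D : mat2) : hyperbolic s T ->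
  m11 D = m22 D ->
  m11 D * m22 T + m11 T * m22 D - (m12 D * m21 T + m12 T * m21 D) = 0 ->
  skew T D (zval s T, 1) < 0 -> dzval s T D < 0.
Proof.
intros hT hD hdet hsk.
destruct (hyperbolic_facts s T hT) as (hr & hr2 & hbd & hb & hd & hlr & hl1 & hTz).
destruct hT as [hs ha hm _].
unfold skew in hsk; rewrite hTz in hsk; unfold zval, dzval in *; unfold mapp in hsk; cbn [fst snd] in hsk.
rewrite <- hD, <- hm in *.
set (r := sqrt (m11 T ^ 2 - 1)) in *; set (l := decay_rate s T) in *.
set (a := m11 T) in *; set (b := m12 T) in *; set (d := m21 T) in *.
set (a' := m11 D) in *; set (b' := m12 D) in *; set (d' := m21 D) in *.
assert (hsl : 0 < s * l).
{ assert (e : (s * l) * (s * a + r) = 1).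
  { transitivity (l * (s ^ 2 * a + s * r)); [ring|rewrite hs; lra]. }
  assert (0 < s * a + r) by lra. nra. }
apply Rmult_lt_reg_l with (2 * r * (s * l)); [apply Rmult_lt_0_compat; lra|].
rewrite Rmult_0_r; eapply Rle_lt_trans; [|exact hsk]; apply Req_le.
assert (hb' : b = r ^ 2 / d) by (rewrite <- hbd; field; exact hd).
assert (haa : a * a' = (b' * d + b * d') / 2) by lra.
rewrite haa, hb'.
(* Both sides are l (d' Z^2 - b') with Z^2 = r^2 / d^2. *)
transitivity (s ^ 2 * l * (r ^ 2 * d' / d ^ 2 - b')).
- field; split; [exact hd|lra].
- transitivity (l * (s ^ 2 * r ^ 2 * d' / d ^ 2 - b')); [rewrite hs; field; exact hd|].
  field; exact hd.
Qed.

Lemma locally_lt (f : R -> R) (x l : R) : continuous f x -> f x < l ->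
  locally x (fun y => f y < l).
Proof. intros hf h; apply (hf (fun y => y < l)), open_lt, h. Qed.

Lemma locally_gt (f : R -> R) (x l : R) : continuous f x -> l < f x ->
  locally x (fun y => l < f y).
Proof. intros hf h; apply (hf (fun y => l < y)), open_gt, h. Qed.

Lemma locally_neq (f : R -> R) (x : R) : continuous f x -> f x <> 0 ->
  locally x (fun y => f y <> 0).
Proof. intros hf h; apply (hf (fun y => y <> 0)), open_neq, h. Qed.

(** Obtained by differentiating m11 = m22 and det = 1 for the cell matrix. *)
Lemma derivative_symmetries (c : unit_cell) (q e1 e2 : R -> R) (w dq de1 de2 : R) :
  q w <> 0 -> e1 w <> 0 -> e2 w <> 0 ->
  is_derive q w dq -> is_derive e1 w de1 -> is_derive e2 w de2 ->
  let T := cell_matrix c (q w) (e1 w) (e2 w) in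
  let D := dcell_matrix c (q w) dq (e1 w) de1 (e2 w) de2 in
  m11 D = m22 D /\
  m11 D * m22 T + m11 T * m22 D - (m12 D * m21 T + m12 T * m21 D) = 0.
Proof.
intros hq h1 h2 dq' d1 d2 T D.
destruct (is_derive_cell_matrix c q e1 e2 w dq de1 de2 hq h1 h2 dq' d1 d2)
  as (a1 & a2 & a3 & a4); fold D in a1, a2, a3, a4.
set (F := fun t => cell_matrix c (q t) (e1 t) (e2 t)).
split.
- rewrite <- (is_derive_unique _ _ _ a1); apply is_derive_unique.
  apply (is_derive_ext (fun t => m22 (F t))); [|exact a4].
  intros t; symmetry; apply cell_matrix_mirror.
- assert (hd : is_derive (fun t => mdet (F t)) w
    (m11 D * m22 T + m11 T * m22 D - (m12 D * m21 T + m12 T * m21 D))).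
  { apply (is_derive_ext (fun t => m11 (F t) * m22 (F t) + - m12 (F t) * m21 (F t))).
    - intros t; unfold mdet; simpl; ring.
    - evar_last.
      + apply (is_derive_dot (fun t => m11 (F t)) (fun t => m22 (F t))
          (fun t => - m12 (F t)) (fun t => m21 (F t)));
        [exact a1|exact a4|exact (is_derive_opp _ _ _ a2)|exact a3].
      + unfold opp, F; simpl; fold T; ring. }
  rewrite <- (is_derive_unique _ _ _ hd).
  apply is_derive_unique, (is_derive_ext_loc (fun _ => 1)); [|exact (is_derive_const (1 : R) w)].
  generalize (filter_and _ _ (locally_neq q w (is_derive_continuous _ _ _ dq') hq)
    (filter_and _ _ (locally_neq e1 w (is_derive_continuous _ _ _ d1) h1)
    (locally_neq e2 w (is_derive_continuous _ _ _ d2) h2))).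
  apply filter_imp; intros t (tq & t1 & t2); symmetry; apply mdet_cell_matrix; assumption.
Qed.

Lemma zval_derivative_neg (c : unit_cell) (mu0 w s : R) (e1 e2 : R -> R) (Z : R -> R) (de1 de2 : R) :
  mu0 <> 0 -> w <> 0 -> e1 w <> 0 -> e2 w <> 0 ->
  is_derive e1 w de1 -> is_derive e2 w de2 ->
  let T := cell_matrix c (mu0 * w ^ 2) (e1 w) (e2 w) in
  let D := dcell_matrix c (mu0 * w ^ 2) (mu0 * (2 * w)) (e1 w) de1 (e2 w) de2 in
  s ^ 2 = 1 -> 1 < s * m11 T ->
  (forall t, mu0 * t ^ 2 <> 0 -> e1 t <> 0 -> e2 t <> 0 ->
    hyperbolic s (cell_matrix c (mu0 * t ^ 2) (e1 t) (e2 t)) ->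
    Z t = zval s (cell_matrix c (mu0 * t ^ 2) (e1 t) (e2 t))) ->
  is_derive Z w (dzval s T D).
Proof.
intros hmu hw h1 h2 d1 d2 T D hs hT hZ.
set (q := fun t => mu0 * t ^ 2).
assert (hq : q w <> 0).
{ apply Rmult_integral_contrapositive_currified; [exact hmu|exact (pow_nonzero w 2 hw)]. }
assert (dq : is_derive q w (mu0 * (2 * w))) by (unfold q; auto_derive; [trivial|ring]).
set (F := fun t => cell_matrix c (q t) (e1 t) (e2 t)).
assert (dF : is_derive_mat F w D) by exact (is_derive_cell_matrix c q e1 e2 w _ _ _ hq h1 h2 dq d1 d2).
assert (hTw : hyperbolic s (F w)).
{ split; [exact hs|exact hT|apply cell_matrix_mirror|apply mdet_cell_matrix; assumption]. }
destruct (hyperbolic_facts s _ hTw) as (hr & hr2 & _ & _ & hd & _).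
apply (is_derive_ext_loc (fun t => zval s (F t))).
- assert (hsa : continuous (fun t => s * m11 (F t)) w).
  { apply continuous_Rmult; [apply continuous_const|].
    destruct dF as [h _]; exact (is_derive_continuous _ _ _ h). }
  generalize (filter_and _ _ (locally_neq q w (is_derive_continuous _ _ _ dq) hq)
    (filter_and _ _ (locally_gt _ w 1 hsa hT)
    (filter_and _ _ (locally_neq e1 w (is_derive_continuous _ _ _ d1) h1)
    (locally_neq e2 w (is_derive_continuous _ _ _ d2) h2)))).
  apply filter_imp; intros t (tq & ta & t1 & t2); symmetry; apply hZ; try assumption.
  split; [exact hs|exact ta|apply cell_matrix_mirror|apply mdet_cell_matrix; assumption].
- apply (is_derive_zval s w F D dF); [|exact hd].
  rewrite <- hr2; apply pow_lt, hr.
Qed.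

(** The quantities that control the sign of the derivative are continuous in
    the perturbation parameter, so that the strict inequalities at 0 persist. *)
Lemma perturbed_derivative_neg (c : unit_cell) (mu0 w s e1 e2 de1 de2 f1 f2 df1 df2 : R) :
  0 < mu0 -> 0 < w -> e1 <> 0 -> e2 <> 0 -> 0 <= de1 -> 0 <= de2 ->
  hyperbolic s (cell_matrix c (mu0 * w ^ 2) e1 e2) ->
  dzval s (cell_matrix c (mu0 * w ^ 2) e1 e2)
    (dcell_matrix c (mu0 * w ^ 2) (mu0 * (2 * w)) e1 de1 e2 de2) < 0 ->
  locally 0 (fun delta =>
    e1 + delta * f1 <> 0 /\ e2 + delta * f2 <> 0 /\
    let T := cell_matrix c (mu0 * w ^ 2) (e1 + delta * f1) (e2 + delta * f2) in
    let D := dcell_matrix c (mu0 * w ^ 2) (mu0 * (2 * w)) (e1 + delta * f1) (de1 + delta * df1)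
      (e2 + delta * f2) (de2 + delta * df2) in
    1 < s * m11 T /\ dzval s T D < 0).
Proof.
intros hmu hw h1 h2 hde1 hde2 hT hneg.
assert (hq : mu0 * w ^ 2 <> 0).
{ apply Rgt_not_eq, Rmult_lt_0_compat; [exact hmu|apply pow_lt, hw]. }
assert (hder : forall e f : R, ex_derive (fun delta => e + delta * f) 0) by (intros; auto_derive; trivial).
assert (hcont : forall e f : R, continuous (fun delta => e + delta * f) 0)
  by (intros; apply (ex_derive_continuous (fun delta => e + delta * f)), hder).
assert (h0 : forall e f : R, e + 0 * f = e) by (intros; ring).
destruct (continuous_cell_matrices c (mu0 * w ^ 2) (mu0 * (2 * w)) 0
  (fun delta => e1 + delta * f1) (fun delta => de1 + delta * df1)
  (fun delta => e2 + delta * f2) (fun delta => de2 + delta * df2)) as [hcT hcD];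
  try (rewrite h0; assumption); try assumption; try apply hder; try apply hcont.
set (T := fun delta => cell_matrix c (mu0 * w ^ 2) (e1 + delta * f1) (e2 + delta * f2)) in hcT.
set (D := fun delta => dcell_matrix c (mu0 * w ^ 2) (mu0 * (2 * w)) (e1 + delta * f1)
  (de1 + delta * df1) (e2 + delta * f2) (de2 + delta * df2)) in hcD.
assert (eT : T 0 = cell_matrix c (mu0 * w ^ 2) e1 e2) by (unfold T; rewrite !h0; reflexivity).
assert (eD : D 0 = dcell_matrix c (mu0 * w ^ 2) (mu0 * (2 * w)) e1 de1 e2 de2)
  by (unfold D; rewrite !h0; reflexivity).
destruct hcT as (T1 & _ & T3 & _); destruct hcD as (D1 & _ & D3 & _).
change (fun y => m11 (cell_matrix c (mu0 * w ^ 2) (e1 + y * f1) (e2 + y * f2))) with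
  (fun y => m11 (T y)) in T1.
rewrite <- eT, <- eD in hneg; rewrite <- eT in hT.
destruct (hyperbolic_facts s _ hT) as (hr & _ & _ & _ & hd & _).
assert (hk : forall r : R, continuous (fun _ : R => r) 0) by (intros; apply continuous_const).
assert (hsq : continuous (fun y => sqrt (m11 (T y) ^ 2 - 1)) 0).
{ apply (continuous_comp (fun y => m11 (T y) ^ 2 - 1) sqrt); [|apply continuous_sqrt].
  apply (continuous_ext (fun y => m11 (T y) * m11 (T y) + - (1))).
  - intros y; lazymatch goal with |- ?a = ?b => change (a = b :> R) end; ring.
  - apply continuous_Rplus; [apply continuous_Rmult; exact T1|apply hk]. }
assert (hz : continuous (fun y => dzval s (T y) (D y)) 0).
{ unfold dzval.
  assert (T33 : continuous (fun y => m21 (T y) ^ 2) 0).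
  { apply (continuous_ext (fun y => m21 (T y) * m21 (T y))).
    - intros y; lazymatch goal with |- ?a = ?b => change (a = b :> R) end; ring.
    - apply continuous_Rmult; exact T3. }
  apply continuous_Rplus; [|apply continuous_Ropp]; apply continuous_Rdiv.
  - apply pow_nonzero, hd.
  - apply continuous_Rmult; [apply continuous_Rmult; [apply hk|exact hsq]|exact D3].
  - exact T33.
  - apply Rmult_integral_contrapositive_currified; [lra|exact hd].
  - apply continuous_Rmult; [apply hk|apply continuous_Rmult; [exact T1|exact D1]].
  - apply continuous_Rmult; [exact hsq|exact T3]. }
assert (hsT : continuous (fun y => s * m11 (T y)) 0) by (apply continuous_Rmult; [apply hk|exact T1]).
assert (n1 : locally 0 (fun y => e1 + y * f1 <> 0))
  by (apply (locally_neq (fun y => e1 + y * f1)); [apply hcont|rewrite h0; exact h1]).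
assert (n2 : locally 0 (fun y => e2 + y * f2 <> 0))
  by (apply (locally_neq (fun y => e2 + y * f2)); [apply hcont|rewrite h0; exact h2]).
generalize (filter_and _ _ n1 (filter_and _ _ n2
  (filter_and _ _ (locally_gt _ 0 1 hsT (hyp_trace _ _ hT)) (locally_lt _ 0 0 hz hneg)))).
apply filter_imp; intros y (a & b & d & e); repeat split; assumption.
Qed.

Lemma is_derive_perturb (delta w de df : R) (e f : R -> R) :
  is_derive e w de -> is_derive f w df ->
  is_derive (perturb delta e f) w (de + delta * df).
Proof.
intros he hf; unfold perturb; auto_derive; [repeat split; eexists; eassumption|].
rw_derive he; rw_derive hf; ring.
Qed.

(** Common part of the two half lines: [Z delta] is any function given by [zval]
    at the frequencies with a hyperbolic cell matrix. *)
Lemma perturbed_impedance_decreasing (c : unit_cell) (mu0 omega : R) (eps1 eps2 f1 f2 : R -> R)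
    (Z : R -> R -> R) :
  0 < mu0 -> 0 < omega -> eps1 omega <> 0 -> eps2 omega <> 0 ->
  piecewise_nondecreasing eps1 -> piecewise_nondecreasing eps2 ->
  ex_derive eps1 omega -> ex_derive eps2 omega ->
  ex_derive f1 omega -> ex_derive f2 omega ->
  ~ bands c mu0 eps1 eps2 omega ->
  (forall delta s t,
    let e1 := perturb delta eps1 f1 t in let e2 := perturb delta eps2 f2 t in
    mu0 * t ^ 2 <> 0 -> e1 <> 0 -> e2 <> 0 ->
    hyperbolic s (cell_matrix c (mu0 * t ^ 2) e1 e2) ->
    Z delta t = zval s (cell_matrix c (mu0 * t ^ 2) e1 e2)) ->
  at_right 0 (fun delta => ex_derive (Z delta) omega /\ Derive (Z delta) omega < 0).
Proof.
intros hmu hw h1 h2 hm1 hm2 d1 d2 df1 df2 hb hZ.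
assert (hq : 0 < mu0 * omega ^ 2) by (apply Rmult_lt_0_compat; [exact hmu|apply pow_lt, hw]).
destruct (gap_hyperbolic c mu0 omega eps1 eps2) as [s hT]; try assumption; [lra|].
specialize (hm1 omega d1); specialize (hm2 omega d2).
apply Derive_correct in d1; apply Derive_correct in d2.
apply Derive_correct in df1; apply Derive_correct in df2.
assert (hneg : dzval s (cell_matrix c (mu0 * omega ^ 2) (eps1 omega) (eps2 omega))
  (dcell_matrix c (mu0 * omega ^ 2) (mu0 * (2 * omega)) (eps1 omega) (Derive eps1 omega)
    (eps2 omega) (Derive eps2 omega)) < 0).
{ destruct (derivative_symmetries c (fun t => mu0 * t ^ 2) eps1 eps2 omega (mu0 * (2 * omega))
    (Derive eps1 omega) (Derive eps2 omega)) as [e e']; try assumption; [lra| |].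
  { auto_derive; [trivial|ring]. }
  apply dzval_neg; try assumption.
  apply skew_dcell_matrix_neg; try assumption; [lra|nra|].
  intros e0; injection e0; lra. }
apply (filter_le_within (F := locally 0)).
generalize (perturbed_derivative_neg c mu0 omega s _ _ _ _ (f1 omega) (f2 omega)
  (Derive f1 omega) (Derive f2 omega) hmu hw h1 h2 hm1 hm2 hT hneg).
apply filter_imp; intros delta (n1 & n2 & hTd & hDd).
assert (hd : is_derive (Z delta) omega (dzval s
  (cell_matrix c (mu0 * omega ^ 2) (eps1 omega + delta * f1 omega) (eps2 omega + delta * f2 omega))
  (dcell_matrix c (mu0 * omega ^ 2) (mu0 * (2 * omega))
    (eps1 omega + delta * f1 omega) (Derive eps1 omega + delta * Derive f1 omega)
    (eps2 omega + delta * f2 omega) (Derive eps2 omega + delta * Derive f2 omega)))).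
{ apply (zval_derivative_neg c mu0 omega s (perturb delta eps1 f1) (perturb delta eps2 f2) (Z delta));
    try assumption; try lra.
  - apply is_derive_perturb; assumption.
  - apply is_derive_perturb; assumption.
  - apply (hyp_sign _ _ hT).
  - intros t; apply hZ. }
split; [eexists; exact hd|rewrite (is_derive_unique _ _ _ hd); exact hDd].
Qed.

Theorem theorem6p2 (mu0 : R) (A B : unit_cell) (eps1 eps2 f1 f2 : R -> R)
    (hmu0 : 0 < mu0)
    (hcont1 : forall w, continuous eps1 w)
    (hcont2 : forall w, continuous eps2 w)
    (hmono1 : piecewise_nondecreasing eps1)
    (hmono2 : piecewise_nondecreasing eps2)
    (hf1 : piecewise_smooth f1)
    (hf2 : piecewise_smooth f2)
    (G : R -> Prop) (omega : R)
    (hG : G omega)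
    (homega : 0 < omega)
    (heps1 : eps1 omega <> 0) (heps2 : eps2 omega <> 0)
    (hdeps1 : ex_derive eps1 omega) (hdeps2 : ex_derive eps2 omega)
    (hdf1 : ex_derive f1 omega) (hdf2 : ex_derive f2 omega) :
  (is_band_gap B mu0 eps1 eps2 G ->
     at_right 0 (fun delta =>
       let Z := impedance_plus B mu0 (perturb delta eps1 f1) (perturb delta eps2 f2) in
       ex_derive Z omega /\ Derive Z omega < 0)) /\
  (is_band_gap A mu0 eps1 eps2 G ->
     at_right 0 (fun delta =>
       let Z := impedance_minus A mu0 (perturb delta eps1 f1) (perturb delta eps2 f2) in
       ex_derive Z omega /\ Derive Z omega < 0)).
Proof.
split; intros (a & b & _ & _ & hgap & _); specialize (hgap omega hG).
- apply (perturbed_impedance_decreasing B mu0 omega eps1 eps2 f1 f2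
    (fun delta => impedance_plus B mu0 (perturb delta eps1 f1) (perturb delta eps2 f2)));
    try assumption.
  intros delta s t e1 e2; apply impedance_plus_eq.
- apply (perturbed_impedance_decreasing A mu0 omega eps1 eps2 f1 f2
    (fun delta => impedance_minus A mu0 (perturb delta eps1 f1) (perturb delta eps2 f2)));
    try assumption.
  intros delta s t e1 e2; apply impedance_minus_eq.
Qed.
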